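(* Let $n\ge 3$ be an integer. There is a canonical isomorphism between the automorphism group of the extended cone complex $\overline{M}_{0,n}^{\mathrm{trop}}$ and the automorphism group of the cone complex $M_{0,n}^{\mathrm{trop}}$.
   Context: Trees are finite. A tree $\Gamma$ is a connected graph without cycles, with vertex set $V(\Gamma)$ and edge set $E(\Gamma)$; $E(v)$ is the set of edges incident to $v$ and $\mathrm{val}(v)=|E(v)|$. An $n$-legged tree is a tree $\Gamma$ with a map $\mathrm{leg}_\Gamma\colon I_n=\{1,\dots,n\}\to V(\Gamma)$; put $L(v)=\mathrm{leg}_\Gamma^{-1}(v)$ and $\ell(v)=|L(v)|$. It is stable if $\mathrm{val}(v)+\ell(v)\geq 3$ for every vertex $v$. An isomorphism of $n$-legged trees is a pair of bijections $g_V$, $g_E$ on vertices and edges compatible with incidence and with $L(g_V(v))=L(v)$ for all $v$. For $S\subset E(\Gamma)$, $\Gamma/S$ is the $n$-legged tree obtained by contracting the edges in $S$ (legs are carried along). For a stable $n$-legged tree $\Gamma$ let $C(\Gamma)=\mathbb{R}_{>0}^{E(\Gamma)}$ and $\overline{C(\Gamma)}=\mathbb{R}_{\geq 0}^{E(\Gamma)}$. The cone complex $M_{0,n}^{\mathrm{trop}}$ is obtained by gluing the closed cones $\overline{C(\Gamma)}$, $\Gamma$ ranging over isomorphism classes of stable $n$-legged trees, where the face $\{x_e=0 \text{ for } e\in S\}$ of $\overline{C(\Gamma)}$ is identified with $\overline{C(\Gamma/S)}$ (via $E(\Gamma/S)=E(\Gamma)\setminus S$). A morphism of cone complexes is a continuous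 map sending each closed cone $\sigma$ into some closed cone $\sigma'$ such that $\sigma\to\sigma'$ is the restriction of an integral linear map (with respect to the lattices $\mathbb{Z}^{E(\Gamma)}$). An automorphism is a morphism with an inverse that is also a morphism. The extended cone complex $\overline{M}_{0,n}^{\mathrm{trop}}\supset M_{0,n}^{\mathrm{trop}}$ is obtained by the same gluing from the extended cones $(\mathbb{R}_{\geq 0}\cup\{\infty\})^{E(\Gamma)}$. A face at infinity of such an extended cone is a subset of the form $\{x: x_e=\infty \text{ for } e\in S,\ x_e<\infty\text{ for } e\notin S\}\cong\mathbb{R}_{\geq 0}^{E(\Gamma)\setminus S}$. A morphism of extended cones $\overline\sigma\to\overline\sigma'$ is a continuous map whose restriction to the finite part $\sigma$ is a morphism of cones (restriction of an integral linear map) from $\sigma$ to a face (possibly at infinity) of $\overline\sigma'$. A morphism of extended cone complexes is a continuous map whose restriction to each extended cone $\overline\sigma$ factors through a morphism of extended cones to some extended cone $\overline\sigma'$ of the target; automorphisms are invertible morphisms whose inverse is a morphism. ''Canonical'' means: the isomorphism is restriction $\overline f\mapsto \overline f|_{M_{0,n}^{\mathrm{trop}}}$, with inverse given by extension by linearity (continuity) to the extended cones. *)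

(* Defs.v *)
From HB Require Import structures.
From Stdlib Require Import Relations.
From mathcomp Require Import all_boot all_order all_algebra.
From mathcomp Require Import all_classical all_reals all_analysis.
Import Order.TTheory GRing.Theory Num.Theory numFieldNormedType.Exports.

Set Implicit Arguments.
Unset Strict Implicit.
Unset Printing Implicit Defensive.

Local Open Scope classical_set_scope.
Local Open Scope ring_scope.
Local Open Scope quotient_scope.

(** * Legged graphs, contraction, stable legged trees *)

(* Finite multigraphs with legs labelled by 'I_n. [ends e] is the set of
   endpoints of [e], a singleton when [e] is a loop. Loops and multiple edges
   are allowed so that contraction is defined on all graphs. *)
Record lgraph (n : nat) (V E : finType) := LGraph {
  ends : E -> {set V};
  leg : 'I_n -> V;
  ends_card : forall e, (0 < #|ends e| <= 2)%N }.

Definition legs n V E (G : lgraph n V E) (v : V) : {set 'I_n} :=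
  [set i | leg G i == v]%SET.

Definition valency n V E (G : lgraph n V E) (v : V) : nat :=
  #|[set e | v \in ends G e]%SET|.

(* adjacency through an edge of S *)
Definition adj n V E (G : lgraph n V E) (S : {set E}) : rel V :=
  fun u v => [exists e in S, ends G e == [set u; v]%SET].

Definition connected_graph n V E (G : lgraph n V E) : Prop :=
  (0 < #|V|)%N /\ forall u v : V, connect (adj G [set: E]%SET) u v.

(* The pair (v_i, e_i) at position i of c says that e_i joins v_i to v_(i+1),
   cyclically; a loop gives a cycle of length 1 and two parallel edges one of
   length 2. *)
Definition is_cycle n V E (G : lgraph n V E) (c : seq (V * E)) : bool :=
  [&& c != [::], uniq [seq p.1 | p <- c], uniq [seq p.2 | p <- c] &
      cycle (fun p q => ends G p.2 == [set p.1; q.1]%SET) c].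

Definition is_tree n V E (G : lgraph n V E) : Prop :=
  connected_graph G /\ forall c, ~~ is_cycle G c.

Definition is_stable n V E (G : lgraph n V E) : Prop :=
  forall v, (3 <= valency G v + #|legs G v|)%N.

Definition is_liso n V E V' E' (G : lgraph n V E) (G' : lgraph n V' E')
    (gV : V -> V') (gE : E -> E') : Prop :=
  [/\ bijective gV, bijective gE,
      forall e, ends G' (gE e) = (gV @: ends G e)%SET
    & forall v, legs G' (gV v) = legs G v].

(* Contraction of S: the vertices of the contracted graph are the connected
   components of (V, S), and its edges are those outside S. *)
Definition component n V E (G : lgraph n V E) (S : {set E}) (v : V) : {set V} :=
  [set w | connect (adj G S) v w]%SET.

Definition contract_vert n V E (G : lgraph n V E) (S : {set E}) : finType :=
  {C : {set V} | C \in [set component G S v | v : V]%SET}.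

Definition contract_edge (E : finType) (S : {set E}) : finType :=
  {e : E | e \notin S}.

Fact component_in n V E (G : lgraph n V E) (S : {set E}) (v : V) :
  component G S v \in [set component G S w | w : V]%SET.
Proof. exact: imset_f. Qed.

Definition contract_map n V E (G : lgraph n V E) (S : {set E}) (v : V) :
    contract_vert G S :=
  exist _ (component G S v) (component_in G S v).

Fact contract_ends_card n V E (G : lgraph n V E) (S : {set E})
    (e : contract_edge S) :
  (0 < #|(contract_map G S @: ends G (val e))%SET| <= 2)%N.
Proof.
have /andP[e0 e2] := ends_card G (val e).
rewrite (leq_trans (leq_imset_card _ _) e2) andbT card_gt0.
case/card_gt0P: e0 => v ve; apply/set0Pn.
by exists (contract_map G S v); rewrite imset_f.
Qed.

Definition contract n V E (G : lgraph n V E) (S : {set E}) :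
    lgraph n (contract_vert G S) (contract_edge S) :=
  LGraph (fun i => contract_map G S (leg G i)) (@contract_ends_card n V E G S).

(* Stable n-legged trees on the vertex set 'I_nv and the edge set 'I_ne. Each
   isomorphism class has such members; isomorphic ones have their cones
   identified by [face_glue] (with S empty). *)
Record stree (n : nat) := STree {
  nv : nat;
  ne : nat;
  sgraph :> lgraph n 'I_nv 'I_ne;
  stree_tree : is_tree sgraph;
  stree_stable : is_stable sgraph }.

HB.instance Definition _ n := gen_eqMixin (stree n).
HB.instance Definition _ n := gen_choiceMixin (stree n).

(** * Gluing cones *)

(* One construction serves for both complexes: T is the space of edge lengths
   and z its zero. *)
Definition cone n (T : topologicalType) (G : stree n) : topologicalType :=
  {ptws 'I_(ne G) -> T}.

Definition cones n (T : topologicalType) : topologicalType :=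
  {G : stree n & cone T G}.

(* The face {x_e = 0 for e in S} of the cone of G is identified with the cone
   of any H isomorphic to G / S. *)
Definition face_glue n (T : topologicalType) (z : T) (p q : cones n T) : Prop :=
  exists (S : {set 'I_(ne (tag p))})
         (gV : contract_vert (tag p) S -> 'I_(nv (tag q)))
         (gE : contract_edge S -> 'I_(ne (tag q))),
    [/\ is_liso (contract (tag p) S) (tag q) gV gE,
        forall e, e \in S -> tagged p e = z
      & forall e : contract_edge S, tagged q (gE e) = tagged p (val e)].

Definition glue_rel n (T : topologicalType) (z : T) : rel (cones n T) :=
  fun p q => `[< clos_refl_sym_trans _ (face_glue z) p q >].

Fact glue_rel_refl n (T : topologicalType) (z : T) : reflexive (@glue_rel n T z).
Proof. by move=> p; apply/asboolP; exact: rst_refl. Qed.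

Fact glue_rel_sym n (T : topologicalType) (z : T) : symmetric (@glue_rel n T z).
Proof. by move=> p q; apply/asboolP/asboolP => h; exact: rst_sym. Qed.

Fact glue_rel_trans n (T : topologicalType) (z : T) : transitive (@glue_rel n T z).
Proof.
by move=> q p r /asboolP pq /asboolP qr; apply/asboolP; exact: rst_trans qr.
Qed.

Definition glue_equiv n (T : topologicalType) (z : T) : equiv_rel (cones n T) :=
  EquivRel _ (glue_rel_refl z) (@glue_rel_sym n T z) (@glue_rel_trans n T z).

Definition cone_complex n (T : topologicalType) (z : T) : topologicalType :=
  quotient_topology {eq_quot (glue_equiv n z)}.

Definition point_of n (T : topologicalType) (z : T) (G : stree n)
    (x : cone T G) : cone_complex n z :=
  \pi_{eq_quot (glue_equiv n z)} (existT (cone T) G x).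

Definition nnreal (R : realType) : topologicalType :=
  set_type [set x : R | 0 <= x].

Definition nnereal (R : realType) : topologicalType :=
  set_type [set x : \bar R | (0 <= x)%E].

Definition nnreal0 (R : realType) : nnreal R :=
  exist _ 0 (mem_set (lexx 0 : [set x : R | 0 <= x] 0)).

Definition nnereal0 (R : realType) : nnereal R :=
  exist _ 0%E (mem_set (lexx 0%E : [set x : \bar R | (0 <= x)%E] 0%E)).

Fact nnreal_ext_proof (R : realType) (x : nnreal R) :
  (\val x)%:E \in [set x : \bar R | (0 <= x)%E].
Proof. by apply/mem_set => /=; rewrite lee_fin; exact: (set_valP x). Qed.

Definition nnreal_ext (R : realType) (x : nnreal R) : nnereal R :=
  exist _ (\val x)%:E (nnreal_ext_proof x).

Definition trop (R : realType) (n : nat) : topologicalType :=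
  cone_complex n (nnreal0 R).

Definition extended_trop (R : realType) (n : nat) : topologicalType :=
  cone_complex n (nnereal0 R).

Definition cone_ext (R : realType) n (G : stree n) (x : cone (nnreal R) G) :
    cone (nnereal R) G :=
  fun e => nnreal_ext (x e).

(* Inclusion of the cone complex in its extension, defined on representatives;
   see [trop_incl_point]. *)
Definition trop_incl (R : realType) n (p : trop R n) : extended_trop R n :=
  point_of (nnereal0 R) (cone_ext (tagged (repr p))).

Lemma cone_point_ind n (T : topologicalType) (z : T) (P : cone_complex n z -> Prop) :
  (forall G (x : cone T G), P (point_of z x)) -> forall p, P p.
Proof.
move=> h p; rewrite -(@reprK _ {eq_quot (glue_equiv n z)} p).
by case: (repr p) => G x; exact: h.
Qed.

Fact trop_incl_point (R : realType) n (G : stree n) (x : cone (nnreal R) G) :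
  trop_incl (point_of (nnreal0 R) x) = point_of (nnereal0 R) (cone_ext x).
Proof.
rewrite /trop_incl; set p := repr _.
have : clos_refl_sym_trans _ (@face_glue n _ (nnreal0 R)) p (existT _ G x).
  apply/asboolP.
  have := reprK (point_of (nnreal0 R) x).
  by rewrite -/p => /eqmodP.
have ext0 : nnreal_ext (nnreal0 R) = nnereal0 R by exact/val_inj.
suff h : forall p q, clos_refl_sym_trans _ (@face_glue n _ (nnreal0 R)) p q ->
  point_of (nnereal0 R) (cone_ext (tagged p)) = point_of (nnereal0 R) (cone_ext (tagged q)).
  by move/h.
move=> {}p q; elim=> [a b|//|a b _ -> //|a b c _ -> _ -> //].
move=> [S [gV [gE [iso xz xe]]]].
apply/eqmodP/asboolP/rst_step; exists S, gV, gE; split => //=.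
- by move=> e eS; rewrite /cone_ext xz.
- by move=> e; rewrite /cone_ext xe.
Qed.

(** * Morphisms *)

Definition lin_image (R : realType) n (G H : stree n)
    (A : 'M[int]_(ne H, ne G)) (x : cone (nnreal R) G) (i : 'I_(ne H)) : R :=
  \sum_j (A i j)%:~R * \val (x j).

(* f maps the cone of G into the cone of H, as the restriction of A. *)
Definition linear_on (R : realType) n (f : trop R n -> trop R n)
    (G H : stree n) (A : 'M[int]_(ne H, ne G)) : Prop :=
  forall x : cone (nnreal R) G, exists2 y : cone (nnreal R) H,
    (forall i, \val (y i) = lin_image A x i)
    & f (point_of (nnreal0 R) x) = point_of (nnreal0 R) y.

Definition is_morphism (R : realType) n (f : trop R n -> trop R n) : Prop :=
  continuous f /\
  forall G : stree n, exists (H : stree n) (A : 'M[int]_(ne H, ne G)),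
    linear_on f A.

(* On finite points phi is the restriction of A into the face
   {y_i = +oo for i in S, y_i < +oo for i not in S}; the rows of A indexed by S
   play no role. *)
Definition is_ext_cone_morphism (R : realType) n (G H : stree n)
    (phi : cone (nnereal R) G -> cone (nnereal R) H) : Prop :=
  continuous phi /\
  exists (S : {set 'I_(ne H)}) (A : 'M[int]_(ne H, ne G)),
    forall (x : cone (nnreal R) G) i,
      \val (phi (cone_ext x) i) =
      if i \in S then +oo%E else (lin_image A x i)%:E.

Definition is_ext_morphism (R : realType) n
    (F : extended_trop R n -> extended_trop R n) : Prop :=
  continuous F /\
  forall G : stree n, exists (H : stree n)
    (phi : cone (nnereal R) G -> cone (nnereal R) H),
    is_ext_cone_morphism phi /\
    forall x, F (point_of (nnereal0 R) x) = point_of (nnereal0 R) (phi x).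

(* The analogue of [linear_on] on extended cones, with 0 * +oo = 0 as in the
   library. *)
Definition ext_linear_on (R : realType) n
    (F : extended_trop R n -> extended_trop R n)
    (G H : stree n) (A : 'M[int]_(ne H, ne G)) : Prop :=
  forall x : cone (nnereal R) G, exists2 y : cone (nnereal R) H,
    (forall i, \val (y i) = \sum_j ((A i j)%:~R)%:E * \val (x j))%E
    & F (point_of (nnereal0 R) x) = point_of (nnereal0 R) y.

(** * Automorphism groups *)

Record endo_monoid (X : Type) := EndoMonoid {
  endo :> set (X -> X);
  endo_id : endo id;
  endo_comp : forall f g, endo f -> endo g -> endo (f \o g) }.

Record aut (X : Type) (C : endo_monoid X) := Aut {
  aut_fun :> X -> X;
  aut_endo : endo C aut_fun;
  aut_invertible :
    exists g, [/\ endo C g, cancel aut_fun g & cancel g aut_fun] }.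

HB.instance Definition _ X (C : endo_monoid X) := gen_eqMixin (aut C).
HB.instance Definition _ X (C : endo_monoid X) := gen_choiceMixin (aut C).

Lemma aut_ext X (C : endo_monoid X) (f g : aut C) : f =1 g -> f = g.
Proof.
case: f g => [f f1 f2] [g g1 g2] /= /funext fg; case: _ / fg g1 g2 => g1 g2.
by congr Aut; exact: Prop_irrelevance.
Qed.

Fact aut_one_invertible X (C : endo_monoid X) :
  exists g, [/\ endo C g, cancel id g & cancel g id].
Proof. by exists id; split=> //; exact: endo_id. Qed.

Definition aut_one X (C : endo_monoid X) : aut C :=
  Aut (endo_id C) (aut_one_invertible C).

Fact aut_mul_invertible X (C : endo_monoid X) (f g : aut C) :
  exists h, [/\ endo C h, cancel (f \o g) h & cancel h (f \o g)].
Proof.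
have [f' [Cf ff' f'f]] := aut_invertible f.
have [g' [Cg gg' g'g]] := aut_invertible g.
by exists (g' \o f'); split; [exact: endo_comp | exact: can_comp..].
Qed.

Definition aut_mul X (C : endo_monoid X) (f g : aut C) : aut C :=
  Aut (endo_comp (aut_endo f) (aut_endo g)) (aut_mul_invertible f g).

Definition aut_inv_fun X (C : endo_monoid X) (f : aut C) : X -> X :=
  projT1 (cid (aut_invertible f)).

Fact aut_inv_funP X (C : endo_monoid X) (f : aut C) :
  [/\ endo C (aut_inv_fun f), cancel f (aut_inv_fun f)
    & cancel (aut_inv_fun f) f].
Proof. exact: projT2 (cid (aut_invertible f)). Qed.

Fact aut_inv_endo X (C : endo_monoid X) (f : aut C) : endo C (aut_inv_fun f).
Proof. by have [] := aut_inv_funP f. Qed.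

Fact aut_inv_invertible X (C : endo_monoid X) (f : aut C) :
  exists h, [/\ endo C h, cancel (aut_inv_fun f) h & cancel h (aut_inv_fun f)].
Proof. by exists f; have [] := aut_inv_funP f; split=> //; exact: aut_endo. Qed.

Definition aut_inv X (C : endo_monoid X) (f : aut C) : aut C :=
  Aut (aut_inv_endo f) (aut_inv_invertible f).

Fact aut_mulA X (C : endo_monoid X) : associative (@aut_mul X C).
Proof. by move=> f g h; exact: aut_ext. Qed.

Fact aut_mul1g X (C : endo_monoid X) : left_id (aut_one C) (@aut_mul X C).
Proof. by move=> f; exact: aut_ext. Qed.

Fact aut_mulg1 X (C : endo_monoid X) : right_id (aut_one C) (@aut_mul X C).
Proof. by move=> f; exact: aut_ext. Qed.

Fact aut_mulVg X (C : endo_monoid X) :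
  left_inverse (aut_one C) (@aut_inv X C) (@aut_mul X C).
Proof.
by move=> f; apply: aut_ext => x /=; have [_ ff' _] := aut_inv_funP f.
Qed.

Fact aut_mulgV X (C : endo_monoid X) :
  right_inverse (aut_one C) (@aut_inv X C) (@aut_mul X C).
Proof.
by move=> f; apply: aut_ext => x /=; have [_ _ f'f] := aut_inv_funP f.
Qed.

HB.instance Definition _ X (C : endo_monoid X) :=
  isGroup.Build (aut C) (@aut_mulA X C) (@aut_mul1g X C) (@aut_mulg1 X C)
    (@aut_mulVg X C) (@aut_mulgV X C).

Fact is_morphism_id (R : realType) n : is_morphism (@id (trop R n)).
Proof.
split=> [x|G]; first exact: cvg_id.
exists G, 1%:M => x; exists x => // i.
rewrite /lin_image (bigD1 i)//= mxE eqxx mul1r big1 ?addr0// => j ji.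
by rewrite mxE eq_sym (negPf ji) mul0r.
Qed.

Fact is_morphism_comp (R : realType) n (f g : trop R n -> trop R n) :
  is_morphism f -> is_morphism g -> is_morphism (f \o g).
Proof.
move=> [cf hf] [cg hg]; split=> [x|G].
  by apply: continuous_comp; [exact: cg | exact: cf].
have [H [A hA]] := hg G; have [K [B hB]] := hf H.
exists K, (B *m A) => x; have [y yE fy] := hA x; have [w wE gw] := hB y.
exists w => [i|/=]; last by rewrite fy.
rewrite wE /lin_image; under eq_bigr do rewrite yE /lin_image mulr_sumr.
rewrite exchange_big/=; apply: eq_bigr => j _.
rewrite mxE raddf_sum/= mulr_suml; apply: eq_bigr => k _.
by rewrite intrM mulrA.
Qed.

Definition trop_endo (R : realType) n : endo_monoid (trop R n) :=
  EndoMonoid (@is_morphism_id R n) (@is_morphism_comp R n).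

Fact is_ext_morphism_id (R : realType) n :
  is_ext_morphism (@id (extended_trop R n)).
Proof.
split=> [x|G]; first exact: cvg_id.
exists G, id; split=> //; split; first by move=> x; exact: cvg_id.
exists finset.set0, 1%:M => x i; rewrite finset.in_set0 /=; congr (_%:E).
rewrite /lin_image (bigD1 i)//= mxE eqxx mul1r big1 ?addr0// => j ji.
by rewrite mxE eq_sym (negPf ji) mul0r.
Qed.

Lemma initial_cvg (S : choiceType) (T : topologicalType) (f : S -> T)
    (F : set_system S) (y : S) :
  Filter F -> f @ F --> f y -> F --> (y : initial_topology f).
Proof.
move=> FF fF A [B [[W oW <-] Wfy] sub]; apply: filterS sub _.
by apply: fF; exact: open_nbhs_nbhs.
Qed.

Lemma cone_cvg n (T : topologicalType) (G : stree n) (x : nat -> cone T G)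
    (y : cone T G) :
  (forall i, (fun m => x m i) @ \oo --> y i) -> x @ \oo --> y.
Proof.
move=> h; apply/cvg_sup => i; apply: initial_cvg; exact: h.
Qed.

Lemma cone_coord_continuous n (T : topologicalType) (G : stree n) i :
  continuous (fun x : cone T G => x i).
Proof. exact: (@proj_continuous _ (fun=> T) i). Qed.

Lemma nnereal_val_continuous (R : realType) :
  continuous (fun x : nnereal R => \val x : \bar R).
Proof. exact: (@initial_continuous _ _ set_val). Qed.

(* The sequence of finite points obtained from an extended one by replacing
   +oo with m. *)
Definition trunc_val (R : realType) (m : nat) (x : nnereal R) : R :=
  if \val x == +oo%E then m%:R else fine (\val x).

Fact trunc_val_ge0 (R : realType) m (x : nnereal R) :
  trunc_val m x \in [set x : R | 0 <= x].
Proof.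
apply/mem_set; rewrite /trunc_val /=; case: ifP => // _.
by apply: fine_ge0; exact: (set_valP x).
Qed.

Definition trunc (R : realType) n (G : stree n) (m : nat)
    (x : cone (nnereal R) G) : cone (nnreal R) G :=
  fun i => exist _ (trunc_val m (x i)) (trunc_val_ge0 m (x i)).

Lemma nnereal_fineK (R : realType) (x : nnereal R) :
  \val x != +oo%E -> (fine (\val x))%:E = \val x.
Proof.
move=> xoo; apply: fineK; rewrite fin_numElt (lt_le_trans _ (set_valP x))//.
by rewrite lt_neqAle xoo leey.
Qed.

Lemma trunc_cvg (R : realType) n (G : stree n) (x : cone (nnereal R) G) :
  (fun m => cone_ext (trunc m x)) @ \oo --> x.
Proof.
apply: cone_cvg => i; apply: initial_cvg.
suff h : (fun m => \val (cone_ext (trunc m x) i)) @ \oo --> \val (x i).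
  exact: h.
have [xoo|xfin] := eqVneq (\val (x i)) +oo%E.
  rewrite xoo (_ : (fun m => _) = (fun m => (m%:R : R)%:E)).
    exact/cvgeryP/cvgr_idn.
  by apply/funext => m; rewrite /= /trunc_val xoo eqxx.
rewrite (_ : (fun m => _) = (fun=> \val (x i))); first exact: cvg_cst.
by apply/funext => m; rewrite /= /trunc_val (negPf xfin) nnereal_fineK.
Qed.

(* The values of a morphism of extended cones at infinity are determined by
   continuity. *)
Lemma ext_cone_morphismE (R : realType) n (G H : stree n)
    (phi : cone (nnereal R) G -> cone (nnereal R) H)
    (S : {set 'I_(ne H)}) (A : 'M[int]_(ne H, ne G)) :
  continuous phi ->
  (forall (x : cone (nnreal R) G) i,
    \val (phi (cone_ext x) i) =
    if i \in S then +oo%E else (lin_image A x i)%:E) ->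
  forall x i, \val (phi x i) =
    if (i \in S) || [exists j, (\val (x j) == +oo%E) && (A i j != 0)]
    then +oo%E else (\sum_j (A i j)%:~R * fine (\val (x j)))%:E.
Proof.
move=> cphi phiE x i.
have phix : (fun m => \val (phi (cone_ext (trunc m x)) i)) @ \oo -->
    \val (phi x i).
  have c (z : cone (nnereal R) G) :
      {for z, continuous (fun x => \val (phi x i) : \bar R)}.
    apply: (continuous_comp _ (@nnereal_val_continuous R _)).
    exact: (continuous_comp (cphi z) (@cone_coord_continuous _ _ _ i _)).
  exact: (cvg_comp _ _ (@trunc_cvg _ _ _ x) (c x)).
have [iS|iS] /= := boolP (i \in S).
  apply: (cvg_unique (@ereal_hausdorff R) phix).
  rewrite (_ : (fun m => _) = (fun=> +oo%E)); first exact: cvg_cst.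
  by apply/funext => m; rewrite phiE iS.
pose a := \sum_j (A i j)%:~R * fine (\val (x j)) : R.
pose b := \sum_(j | \val (x j) == +oo%E) (A i j)%:~R : R.
have seqE m : \val (phi (cone_ext (trunc m x)) i) = (a + b * m%:R)%:E.
  rewrite phiE (negPf iS) /lin_image /a /b /=; congr (_%:E).
  rewrite mulr_suml [X in _ + X]big_mkcond -big_split/=; apply: eq_bigr => j _.
  rewrite /trunc_val; case: ifP => [/eqP xoo|_]; last by rewrite addr0.
  by rewrite [X in fine X]xoo /= mulr0 add0r.
have A0 j : (0 <= A i j)%R.
  pose d : cone (nnreal R) G := fun k =>
    exist _ (k == j)%:R (mem_set (ler0n R (k == j) : [set x : R | 0 <= x] _)).
  have := set_valP (phi (cone_ext d) i).
  rewrite /= [X in (_ <= X)%E](phiE d i) (negPf iS) lee_fin /lin_image.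
  rewrite (bigD1 j)//= eqxx mulr1 big1 ?addr0 ?ler0z// => k kj.
  by rewrite (negPf kj) mulr0.
case: ifPn => [/existsP[j /andP[xj Aj]]|/existsPn noj].
  have b0 : 0 < b.
    rewrite /b (bigD1 j)//= ltr_pwDl ?ltr0z ?lt_neqAle ?A0 1?eq_sym ?Aj//.
    by apply: sumr_ge0 => k _; rewrite ler0z A0.
  apply: (cvg_unique (@ereal_hausdorff R) phix).
  rewrite (_ : (fun m => _) = (fun m => (a + b * m%:R)%:E)); last exact/funext.
  apply/cvgeryP; apply/cvgryPge => M.
  have /cvgryPge/(_ ((M - a) / b)) := @cvgr_idn R.
  apply: filterS => m /=; rewrite ler_pdivrMr// => hm.
  by rewrite addrC -lerBlDr mulrC.
have b0 : b = 0.
  rewrite /b big1// => j xj; have := noj j; rewrite xj /= negbK => /eqP ->.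
  by [].
apply: (cvg_unique (@ereal_hausdorff R) phix).
rewrite (_ : (fun m => _) = (fun=> a%:E)); first exact: cvg_cst.
by apply/funext => m; rewrite seqE b0 mul0r addr0.
Qed.

Fact is_ext_cone_morphism_comp (R : realType) n (G H K : stree n)
    (phi : cone (nnereal R) G -> cone (nnereal R) H)
    (psi : cone (nnereal R) H -> cone (nnereal R) K) :
  is_ext_cone_morphism phi -> is_ext_cone_morphism psi ->
  is_ext_cone_morphism (psi \o phi).
Proof.
move=> [cphi [S [A phiE]]] [cpsi [T [B psiE]]]; split=> [x|].
  by apply: continuous_comp; [exact: cphi | exact: cpsi].
exists (T :|: [set k | [exists j in S, B k j != 0]])%SET.
exists (B *m (\matrix_(i, j) if i \in S then 0 else A i j)) => x k.
rewrite /= (ext_cone_morphismE cpsi psiE) finset.in_setU finset.inE.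
have -> : [exists j, (\val (phi (cone_ext x) j) == +oo%E) && (B k j != 0)] =
    [exists j in S, B k j != 0].
  by apply: eq_existsb => j; rewrite phiE; case: ifP.
case: ifP => // _; congr (_%:E).
rewrite /lin_image; under [RHS]eq_bigr do rewrite mxE raddf_sum/= mulr_suml.
rewrite exchange_big/=; apply: eq_bigr => j _.
rewrite phiE; case: ifP => jS /=.
  rewrite mulr0 big1// => l _; by rewrite mxE jS mulr0 mul0r.
rewrite /lin_image mulr_sumr; apply: eq_bigr => l _.
by rewrite mxE jS intrM mulrA.
Qed.

Fact is_ext_morphism_comp (R : realType) n
    (f g : extended_trop R n -> extended_trop R n) :
  is_ext_morphism f -> is_ext_morphism g -> is_ext_morphism (f \o g).
Proof.
move=> [cf hf] [cg hg]; split=> [x|G].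
  by apply: continuous_comp; [exact: cg | exact: cf].
have [H [phi [mphi phiE]]] := hg G; have [K [psi [mpsi psiE]]] := hf H.
exists K, (psi \o phi); split; first exact: is_ext_cone_morphism_comp.
by move=> x /=; rewrite phiE psiE.
Qed.

Definition extended_trop_endo (R : realType) n :
    endo_monoid (extended_trop R n) :=
  EndoMonoid (@is_ext_morphism_id R n) (@is_ext_morphism_comp R n).

Definition Aut_trop (R : realType) (n : nat) : Type := aut (trop_endo R n).

Definition Aut_extended_trop (R : realType) (n : nat) : Type :=
  aut (extended_trop_endo R n).

HB.instance Definition _ (R : realType) n :=
  Group.copy (Aut_trop R n) (aut (trop_endo R n)).
HB.instance Definition _ (R : realType) n :=
  Group.copy (Aut_extended_trop R n) (aut (extended_trop_endo R n)).

(* Composition is the group law of automorphism groups: (f * g) x = f (g x). *)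
Lemma autM X (C : endo_monoid X) (f g : aut C) x : (f * g)%g x = f (g x).
Proof. by []. Qed.

Lemma aut1 X (C : endo_monoid X) x : (1 : aut C)%g x = x.
Proof. by []. Qed.

Definition restricts_to (R : realType) n
    (F : extended_trop R n -> extended_trop R n) (f : trop R n -> trop R n) :
    Prop :=
  forall p, F (trop_incl p) = trop_incl (f p).

(* Main.v *)
From HB Require Import structures.
From Stdlib Require Import Relations.
Require Import Defs.
From mathcomp Require Import all_boot all_order all_algebra.

(** Why the theorem is true.

    A point of either complex is a stable tree with lengths on its edges, up
    to isomorphism and contraction of the edges of length zero. Cutting an
    edge splits the legs into two classes, and the proof works in the
    coordinates [width s]: the length of the edge inducing the split [s], or
    zero if there is none. They are well defined and continuous, because
    distinct edges of a stable tree induce distinct splits ([leg_split_inj])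
    and contraction does not change the splits of the surviving edges. They
    separate points ([width_inj]), because a stable tree can be recovered from
    its splits ([reconstruction]). Hence the extended complex is Hausdorff.

    Finite points are dense in it ([trop_trunc_cvg]: replace infinite lengths
    by larger and larger finite ones), so a continuous map is determined by
    its restriction to finite points ([extended_trop_ext]). Uniqueness,
    multiplicativity and the fact that the two constructions below are inverse
    to each other all follow from this.

    Extension ([extension_exists]). A morphism is given on each cone by a
    matrix, whose entries are nonnegative because it maps a nonnegative orthant
    to another one. Such a matrix still acts continuously when infinite
    lengths are allowed. Its value at a point is the limit of values of the
    morphism at finite points, so it depends neither on the cone nor on the
    matrix chosen.

    Restriction ([restriction_exists]). A morphism F of the extended complex
    might send the finite part of a cone to a face at infinity, making the
    length of some split s infinite. All cones share their apex, so the image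
    of the apex has infinite s-length; then on every cone that coordinate
    is infinite at the apex, hence on all finite points, hence everywhere by
    continuity. A surjective F cannot do that, since the apex is a value
    of F ([no_face_at_infinity]). *)

Set Implicit Arguments.
Unset Strict Implicit.
Unset Printing Implicit Defensive.

(** * Sides of a bridge *)

Lemma imset_pair (A B : finType) (f : A -> B) a b :
  f @: [set a; b] = [set f a; f b].
Proof. by rewrite imsetU1 imset_set1. Qed.

Section Bridges.
Variables (n : nat) (V E : finType) (G : lgraph n V E).
Implicit Types S T : {set E}.

Definition sameside e := connect (adj G (~: [set e])).

Definition bridged := forall e u v,
  ends G e = [set u; v] -> ~~ sameside e u v.

Lemma adj_sym S : symmetric (adj G S).
Proof. by move=> u v; apply: eq_existsb => e; rewrite setUC. Qed.

Lemma connect_adj_sym S : connect_sym (adj G S).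
Proof. exact: sym_connect_sym (adj_sym S). Qed.

Lemma connect_adjS (S T : {set E}) : S \subset T ->
  subrel (connect (adj G S)) (connect (adj G T)).
Proof.
move=> ST u v; apply: connect_sub u v => u v /existsP[e /andP[eS ee]].
by apply: connect1; apply/existsP; exists e; rewrite (subsetP ST).
Qed.

Lemma ends_pair e : exists u v, ends G e = [set u; v].
Proof.
have /andP[e0] := ends_card G e; rewrite leq_eqVlt => /orP [/cards2P[u [v [_ ->]]]|].
  by exists u, v.
rewrite ltnS => e1; have /cards1P[u ->] : #|ends G e| == 1%N by rewrite eqn_leq e1.
by exists u, u; rewrite setUid.
Qed.

Lemma connect_ends S e u v : e \in S -> u \in ends G e -> v \in ends G e ->
  connect (adj G S) u v.
Proof.
move=> eS; have [a [b eab]] := ends_pair e.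
have ab : connect (adj G S) a b.
  by apply: connect1; apply/existsP; exists e; rewrite eS eab /=.
rewrite eab !inE => /orP[]/eqP -> /orP[]/eqP -> //.
by rewrite connect_adj_sym.
Qed.

Lemma sameside_refl e : reflexive (sameside e).
Proof. exact: connect0. Qed.

Lemma sameside_sym e : symmetric (sameside e).
Proof. exact: connect_adj_sym. Qed.

Lemma sameside_trans e : transitive (sameside e).
Proof. exact: connect_trans. Qed.

Lemma connect_sameside S e u v : e \notin S ->
  connect (adj G S) u v -> sameside e u v.
Proof.
move=> eS; apply: connect_adjS; apply/subsetP => f fS; rewrite !inE.
by apply: contraNneq eS => <-.
Qed.

Lemma sameside_ends e f u v : e != f -> u \in ends G f -> v \in ends G f ->
  sameside e u v.
Proof. by move=> ef; apply: connect_ends; rewrite !inE eq_sym. Qed.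

(** A path either avoids [f] or runs, up to its first passage through [f], from
    its origin to an end of [f]. *)
Lemma connect_cut S f u v : connect (adj G S) u v ->
  connect (adj G (S :\ f)) u v \/
  exists2 a, a \in ends G f & connect (adj G (S :\ f)) u a.
Proof.
case/connectP => p; elim: p u => [|w p IH] u /=; first by move=> _ ->; left.
case/andP => /existsP[e /andP[eS /eqP eE]] pw lw.
have [ef|ef] := eqVneq e f.
  by right; exists u => //; rewrite -ef eE !inE eqxx.
have uw : connect (adj G (S :\ f)) u w.
  by apply: connect1; apply/existsP; exists e; rewrite !inE ef eS eE /=.
case: (IH _ pw lw) => [wv|[a af wa]].
  by left; exact: connect_trans wv.
by right; exists a => //; exact: connect_trans wa.
Qed.

Hypotheses (connG : connected_graph G) (bridG : bridged).

(** Edges can be forbidden one at a time. If [u] and [v] were disconnected by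
    forbidding [f] as well, each would still reach an end of [f]; reaching the
    same end connects them, and reaching opposite ends makes them lie on
    different sides of the bridge [f]. *)
Lemma connect_sameside_seq (s : seq E) u v : {in s, forall f, sameside f u v} ->
  connect (adj G (~: [set f in s])) u v.
Proof.
elim: s => [|f s IH] side.
  rewrite (_ : ~: _ = [set: E]); first by case: connG.
  by apply/setP => e; rewrite !inE.
have -> : ~: [set g in f :: s] = (~: [set g in s]) :\ f.
  by apply/setP => g; rewrite !inE negb_or.
have uv : connect (adj G (~: [set g in s])) u v.
  by apply: IH => g gs; apply: side; rewrite inE gs orbT.
have [//|[a af ua]] := connect_cut f uv.
have vu : connect (adj G (~: [set g in s])) v u by rewrite connect_adj_sym.
have [|[b bf vb]] := connect_cut f vu; first by rewrite connect_adj_sym.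
have [ab|ab] := eqVneq a b.
  by apply: connect_trans ua _; rewrite ab connect_adj_sym.
have fab : ends G f = [set a; b].
  have [c [d fcd]] := ends_pair f; move: af bf ab; rewrite fcd !inE.
  by do 2!case/orP => /eqP ->; rewrite ?eqxx // setUC.
have fN : f \notin (~: [set g in s]) :\ f by rewrite !inE eqxx.
case/negP: (bridG fab).
apply: (@sameside_trans _ u); first by rewrite sameside_sym; exact: connect_sameside ua.
apply: (@sameside_trans _ v); last exact: connect_sameside vb.
by apply: side; rewrite inE eqxx.
Qed.

(** This replaces paths by sides of edges: from here on a tree is a family of
    two-class equivalence relations on its vertices. *)
Lemma connectE S u v :
  connect (adj G S) u v = [forall f in ~: S, sameside f u v].
Proof.
apply/idP/forall_inP => [uv f|side]; first by rewrite inE => /connect_sameside; apply.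
have := @connect_sameside_seq (enum (~: S)) u v.
rewrite (_ : ~: [set f in enum (~: S)] = S); last first.
  by apply/setP => e; rewrite in_setC inE mem_enum in_setC negbK.
by apply=> f; rewrite mem_enum; exact: side.
Qed.

Lemma connect_set0 u v : connect (adj G set0) u v = (u == v).
Proof.
apply/idP/eqP => [/connectP[[|w p] /= pw ->//]|->//].
by case/andP: pw => /existsP[e]; rewrite inE.
Qed.

Lemma sameside_eq u v : (forall e, sameside e u v) -> u = v.
Proof.
by move=> side; apply/eqP; rewrite -connect_set0 connectE; apply/forall_inP.
Qed.

(** By [connectE] such vertices are joined by a path through [e] alone. *)
Lemma ends_separated e u v : ~~ sameside e u v ->
  (forall f, f != e -> sameside f u v) -> ends G e = [set u; v].
Proof.
move=> uv side; have : connect (adj G [set e]) u v.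
  by rewrite connectE; apply/forall_inP => f; rewrite !inE; exact: side.
have uDv : u != v by apply: contraNneq uv => ->; exact: sameside_refl.
case/connectP => p pp lp; move: uDv {uv side}; rewrite {}lp.
elim/last_ind: p pp => [|p w IH] //=; first by rewrite eqxx.
rewrite last_rcons rcons_path => /andP[/IH{}IH /existsP[f /andP[/set1P -> /eqP fE]]].
have [ul|/IH fu uw] := eqVneq u (last u p); first by rewrite fE -ul.
have : w \in ends G e by rewrite fE !inE eqxx orbT.
by rewrite fu !inE eq_sym (negPf uw) => /eqP ->.
Qed.

(** The path from [v] to [w] avoids [f] but has to cross [e], so on the way it
    meets [e] without having crossed [f]. *)
Lemma sameside_cross e f v w : e != f -> sameside f v w -> ~~ sameside e v w ->
  {in ends G e, forall a, sameside f v a}.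
Proof.
move=> ef vw evw a ae; have [vw'|[b be vb]] := connect_cut e vw.
  by case/negP: evw; apply: connect_sameside vw'; rewrite !inE eqxx.
apply: (@sameside_trans _ b); last by apply: sameside_ends be ae; rewrite eq_sym.
by apply: connect_sameside vb; rewrite !inE eqxx andbF.
Qed.

Lemma sameside_end e v : exists2 a, a \in ends G e & sameside e v a.
Proof.
have [a [b eab]] := ends_pair e.
have ae : a \in ends G e by rewrite eab !inE eqxx.
have va : connect (adj G setT) v a by case: connG.
have eN S : e \notin S :\ e by rewrite !inE eqxx.
by have [/connect_sameside|[c ce /connect_sameside]] := connect_cut e va => /(_ e (eN _));
  [exists a|exists c].
Qed.

(** The Helly property of half-trees: if, one from each edge, they meet
    pairwise, they all meet. Treat the edges one by one; when the current
    vertex is on the wrong side of [e], move it to the end of [e] on the right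
    side. For an edge [f] treated before, the half-trees of [e] and [f] meet,
    so [sameside_cross] shows that this end is on the right side of [f]. *)
Lemma helly (r : E -> V) :
  (forall e f, exists w, sameside e w (r e) /\ sameside f w (r f)) ->
  exists v, forall e, sameside e v (r e).
Proof.
move=> pairwise; suff [v vs] : exists v, {in enum E, forall e, sameside e v (r e)}.
  by exists v => e; apply: vs; rewrite mem_enum.
elim: (enum E) => [|e s [v vs]]; first by have [/card_gt0P[v _] _] := connG; exists v.
have [ve|ve] := boolP (sameside e v (r e)).
  by exists v => f; rewrite inE => /orP[/eqP -> //|/vs].
have [a ae ra] := sameside_end e (r e).
exists a => f; rewrite inE => /orP[/eqP ->|fs]; first by rewrite sameside_sym.
have [fe|fe] := eqVneq f e; first by rewrite fe sameside_sym.
have [w [wf we]] := pairwise f e.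
apply: (@sameside_trans _ v); last exact: vs.
rewrite sameside_sym; apply: (@sameside_cross e f v w) => //; first by rewrite eq_sym.
  by apply: sameside_trans (vs _ fs) _; rewrite sameside_sym.
by apply: contra ve => vw; exact: sameside_trans we.
Qed.

(** * Edges and legs leaving a subtree *)

(** What would be incident to the vertex onto which the [S]-component of [c] is
    contracted; edges and legs are put in one type so as to be counted
    together. *)
Definition outgoing (S : {set E}) (c : V) : {set E + 'I_n} :=
  [set t | match t with
           | inl e => (e \notin S) && [exists u in ends G e, connect (adj G S) c u]
           | inr i => connect (adj G S) c (leg G i)
           end].

Hypothesis stabG : is_stable G.

Lemma card_outgoing (S : {set E}) c : #|outgoing S c| =
  (#|[set e | (e \notin S) && [exists u in ends G e, connect (adj G S) c u]]|
  + #|[set i | connect (adj G S) c (leg G i)]|)%N.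
Proof.
set A := [set e | _]; set L := [set i | _].
rewrite -(card_imset A (@inl_inj E 'I_n)).
rewrite -(card_imset L (@inr_inj E 'I_n)).
rewrite -cardsUI (_ : _ :&: _ = set0) ?cards0 ?addn0; last first.
  by apply/setP => t; rewrite !inE; apply/negP => /andP[/imsetP[e _ ->] /imsetP[i _]].
apply: eq_card => -[e|i]; rewrite !inE.
- rewrite (mem_imset _ _ inl_inj) !inE orbC.
  by case: imsetP => // -[].
- rewrite (mem_imset _ _ inr_inj) !inE.
  by case: imsetP => // -[].
Qed.

(** Contraction preserves stability. Contracting one more edge [g = ab] glues
    the components of [a] and [b], which each have at least three outgoing
    elements and lose only [g]; nothing else is shared, as [g] is a bridge, so
    at least four remain. *)
Lemma card_outgoing_ge3 (S : {set E}) c : (3 <= #|outgoing S c|)%N.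
Proof.
elim: {S}#|S| {-2}S (erefl #|S|) c => [|k IH] S cS c.
  move/eqP: cS; rewrite cards_eq0 => /eqP ->; rewrite card_outgoing.
  apply: leq_trans (stabG c) _; apply: eq_leq.
  congr (_ + _)%N; apply: eq_card => x; rewrite !inE.
    apply/idP/existsP => [ce|[u]]; first by exists c; rewrite ce connect0.
    by rewrite connect_set0 => /andP[ue /eqP ->].
  by rewrite connect_set0 eq_sym.
have [S0|[g gS]] := set_0Vmem S; first by rewrite S0 cards0 in cS.
have {}IH := IH (S :\ g).
have {}IH c' : (3 <= #|outgoing (S :\ g) c'|)%N.
  by apply: IH; move: cS; rewrite (cardsD1 g) gS => -[].
have gN : g \notin S :\ g by rewrite !inE eqxx.
have sub c' u : connect (adj G S) c c' -> connect (adj G (S :\ g)) c' u ->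
    connect (adj G S) c u.
  by move=> cc' c'u; apply: connect_trans cc' _; apply: connect_adjS c'u; exact: subsetDl.
have out c' : connect (adj G S) c c' ->
    outgoing (S :\ g) c' :\ inl g \subset outgoing S c.
  move=> cc'; apply/subsetP => -[e|i]; rewrite !inE.
    rewrite -[_ != _]/(e != g) negb_and negbK.
    case/and3P=> [/negPf -> /= -> /existsP[u /andP[ue cu]]].
    by apply/existsP; exists u; rewrite ue; exact: sub cu.
  by move=> /= ci; exact: sub ci.
(* [g] lies outside the component of [c] unless some end of it is reached. *)
have [/existsP[a0 /andP[a0g ca0]]|noa] :=
  boolP [exists a in ends G g, connect (adj G S) c a]; last first.
  apply: leq_trans (IH c) (subset_leq_card _).
  apply/subsetP => t tc; apply: (subsetP (out c (connect0 _ _))).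
  rewrite in_setD1 tc andbT; apply: contraNneq noa => tg.
  move: tc; rewrite tg !inE => /andP[_ /existsP[u /andP[ug cu]]].
  by apply/existsP; exists u; rewrite ug; exact: sub cu.
have [a [b gab]] := ends_pair g.
have ag : a \in ends G g by rewrite gab !inE eqxx.
have bg : b \in ends G g by rewrite gab !inE eqxx orbT.
have ca : connect (adj G S) c a by apply: connect_trans ca0 _; exact: connect_ends a0g ag.
have cb : connect (adj G S) c b by apply: connect_trans ca0 _; exact: connect_ends a0g bg.
have ab0 : (outgoing (S :\ g) a :\ inl g) :&: (outgoing (S :\ g) b :\ inl g) = set0.
  have sg c' u : connect (adj G (S :\ g)) c' u -> sameside g c' u.
    exact: connect_sameside.
  apply/setP => t; rewrite !inE; apply/negP => /andP[/andP[tg ta] /andP[_ tb]].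
  case/negP: (bridG gab); case: t tg ta tb => [e|i] /= tg; last first.
    by move=> /sg ai /sg bi; apply: sameside_trans ai _; rewrite sameside_sym.
  case/andP=> _ /existsP[x /andP[xe /sg ax]] /andP[_ /existsP[y /andP[ye /sg yb]]].
  apply: sameside_trans ax _; rewrite sameside_sym.
  apply: sameside_trans yb _; apply: sameside_ends ye xe.
  by rewrite eq_sym; apply: contraNneq tg => ->.
have two c' : (2 <= #|outgoing (S :\ g) c' :\ inl g|)%N.
  have := IH c'; rewrite (cardsD1 (inl g)); case: (_ \in _) => //=.
  by rewrite add0n => /ltnW.
have : outgoing (S :\ g) a :\ inl g :|: outgoing (S :\ g) b :\ inl g \subset outgoing S c.
  by rewrite subUset !out.
move/subset_leq_card; rewrite cardsU ab0 cards0 subn0; apply: leq_trans.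
exact: leq_trans (leq_add (two a) (two b)).
Qed.

(** Contract all edges but [e] and [f]: at most two of the three outgoing
    elements at [v] are edges, so one is a leg. This makes legs see everything:
    splits of the legs determine sides of vertices. *)
Lemma leg_same_sides v e f :
  exists k, sameside e v (leg G k) /\ sameside f v (leg G k).
Proof.
pose S := ~: [set e; f].
have [/existsP[k vk]|noleg] := boolP [exists k, connect (adj G S) v (leg G k)].
  by exists k; split; apply: connect_sameside vk; rewrite !inE eqxx ?orbT.
suff : (#|outgoing S v| <= 2)%N by rewrite leqNgt card_outgoing_ge3.
have sub : outgoing S v \subset inl @: [set e; f].
  apply/subsetP => -[g|k]; rewrite inE.
    by move=> /andP[]; rewrite in_setC negbK => gef _; exact: imset_f.
  by move=> vk; case/negP: noleg; apply/existsP; exists k.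
apply: leq_trans (subset_leq_card sub) _.
by apply: leq_trans (leq_imset_card _ _) _; rewrite cards2; case: (_ != _).
Qed.

(** The split of an edge, encoded as the relation of lying on the same side so
    that neither side has to be preferred. *)
Definition leg_split e : {ffun 'I_n * 'I_n -> bool} :=
  [ffun p => sameside e (leg G p.1) (leg G p.2)].

Lemma leg_splitE e i j : sameside e (leg G i) (leg G j) = leg_split e (i, j).
Proof. by rewrite ffunE. Qed.

(** The ends [a], [b] of [e] are on the same side of [f]. Replacing them by legs
    on the same sides of both [e] and [f] gives two legs that tell the splits
    apart. *)
Lemma leg_split_inj : injective leg_split.
Proof.
move=> e f ef; apply/eqP/negPn/negP => eDf.
have [a [b eab]] := ends_pair e.
have [i [ai ai']] := leg_same_sides a e f; have [j [bj bj']] := leg_same_sides b e f.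
case/negP: (bridG eab).
apply: sameside_trans ai _; rewrite sameside_sym; apply: sameside_trans bj _.
rewrite leg_splitE ef -leg_splitE; rewrite sameside_sym in bj'.
apply: sameside_trans bj' _; apply: sameside_trans ai'.
by apply: (@sameside_ends f e b a); rewrite 1?eq_sym // eab !inE eqxx ?orbT.
Qed.

End Bridges.

(** * A stable tree is determined by its splits *)

(** [v1] and [v2] see the same legs on their side of each edge, which pins down
    one from the other. *)
Definition same_position n V1 E1 V2 E2 (G1 : lgraph n V1 E1) (G2 : lgraph n V2 E2)
    (gE : E1 -> E2) v1 v2 := forall e i,
  sameside G1 e v1 (leg G1 i) = sameside G2 (gE e) v2 (leg G2 i).

Section Reconstruction.
Variables (n : nat) (V1 E1 V2 E2 : finType).
Variables (G1 : lgraph n V1 E1) (G2 : lgraph n V2 E2).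
Hypotheses (conn1 : connected_graph G1) (brid1 : bridged G1) (stab1 : is_stable G1).
Hypotheses (conn2 : connected_graph G2) (brid2 : bridged G2) (stab2 : is_stable G2).
Variable gE : E1 -> E2.
Hypothesis gE_bij : bijective gE.
Hypothesis gE_split : forall e, leg_split G2 (gE e) = leg_split G1 e.

Local Notation same_position := (same_position G1 G2 gE).

(** For each edge pick a leg on the side of [v1]. Two of these half-trees share
    a leg ([leg_same_sides]), and sharing a leg is read off the splits, so the
    corresponding half-trees of [G2] meet pairwise and [helly] applies. *)
Lemma position_exists v1 : exists v2, same_position v1 v2.
Proof.
have [gE' gE'K gEK] := gE_bij.
pose pl := leg_same_sides brid1 stab1.
have [i iP] : exists i : E1 -> 'I_n, forall e, sameside G1 e v1 (leg G1 (i e)).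
  apply: (@fin_all_exists _ (fun=> 'I_n) (fun e k => sameside G1 e v1 (leg G1 k))) => e.
  by have [k []] := pl v1 e e; exists k.
have [|v2 v2P] := @helly _ _ _ G2 conn2 (fun e2 => leg G2 (i (gE' e2))).
  move=> e f; have [k [ek fk]] := pl v1 (gE' e) (gE' f); exists (leg G2 k).
  rewrite -{1}(gEK e) -{1}(gEK f) !leg_splitE !gE_split -!leg_splitE.
  split; [have := iP (gE' e)|have := iP (gE' f)].
    by apply: sameside_trans; rewrite sameside_sym.
  by apply: sameside_trans; rewrite sameside_sym.
exists v2 => e j; have := v2P (gE e); rewrite gE'K => ve.
have ve' := iP e; apply/idP/idP => h.
  apply: sameside_trans ve _; rewrite leg_splitE gE_split -leg_splitE.
  by apply: sameside_trans h; rewrite sameside_sym.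
apply: sameside_trans ve' _; rewrite leg_splitE -gE_split -leg_splitE.
by apply: sameside_trans h; rewrite sameside_sym.
Qed.

(** Replace [v1] and [v2] by a leg on their side. *)
Lemma position_sameside v1 v2 w1 w2 e :
  same_position v1 v2 -> same_position w1 w2 ->
  sameside G1 e v1 w1 = sameside G2 (gE e) v2 w2.
Proof.
move=> v12 w12; have [k [vk _]] := leg_same_sides brid1 stab1 v1 e e.
have vk2 := vk; rewrite v12 in vk2.
apply/idP/idP => h.
  apply: sameside_trans vk2 _; rewrite sameside_sym -w12.
  by apply: sameside_trans vk; rewrite sameside_sym.
apply: sameside_trans vk _; rewrite sameside_sym w12.
by apply: sameside_trans vk2; rewrite sameside_sym.
Qed.

End Reconstruction.

(** Vertices correspond when they have the same position. Adjacency is then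
    recovered from [ends_separated]: the ends of an edge are the vertices which
    that edge alone separates. *)
Lemma reconstruction n V1 E1 V2 E2 (G1 : lgraph n V1 E1) (G2 : lgraph n V2 E2)
    (gE : E1 -> E2) :
  connected_graph G1 -> bridged G1 -> is_stable G1 ->
  connected_graph G2 -> bridged G2 -> is_stable G2 ->
  bijective gE -> (forall e, leg_split G2 (gE e) = leg_split G1 e) ->
  exists gV, is_liso G1 G2 gV gE.
Proof.
move=> conn1 brid1 stab1 conn2 brid2 stab2 gE_bij gE_split.
have [gE' gE'K gEK] := gE_bij.
have gE'_split e : leg_split G1 (gE' e) = leg_split G2 e by rewrite -gE_split gEK.
have pos := position_exists brid1 stab1 conn2 gE_bij gE_split.
have [gV gVP] := fin_all_exists pos.
have pos' := position_exists brid2 stab2 conn1 (Bijective gEK gE'K) gE'_split.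
have [gV' gV'P] := fin_all_exists pos'.
have gV_side u v e : sameside G1 e u v = sameside G2 (gE e) (gV u) (gV v).
  exact: position_sameside.
have gV_uniq u v : same_position G1 G2 gE u v -> gV u = v.
  move=> uv; apply: (sameside_eq conn2 brid2) => e; rewrite -[e]gEK.
  rewrite -(@position_sameside _ _ _ _ _ G1 G2 brid1 stab1 gE u (gV u) u v) //.
  exact: sameside_refl.
exists gV; split => //.
- exists gV' => v.
    apply: (sameside_eq conn1 brid1) => e; rewrite gV_side.
    suff -> : gV (gV' (gV v)) = gV v by exact: sameside_refl.
    by apply: gV_uniq => f i; rewrite -[in LHS](gE'K f) -gV'P.
  by apply: gV_uniq => f i; rewrite -[in LHS](gE'K f) -gV'P.
- move=> e; have [u [v euv]] := ends_pair G1 e; rewrite euv imset_pair.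
  apply: (ends_separated conn2 brid2); first by rewrite -gV_side; exact: brid1.
  move=> f; rewrite -(gEK f) -gV_side => fe.
  have gfe : gE' f != e by apply: contraNneq fe => <-; rewrite gEK.
  by apply: (sameside_ends gfe); rewrite euv !inE eqxx ?orbT.
- move=> v; apply/setP => i; rewrite !inE.
  have legi : gV (leg G1 i) = leg G2 i.
    by apply: gV_uniq => e j; rewrite !leg_splitE gE_split.
  rewrite -legi; apply/eqP/eqP => [gVi|-> //].
  by apply: (sameside_eq conn1 brid1) => e; rewrite gV_side gVi; exact: sameside_refl.
Qed.

(** * Cycles and bridges *)

Section Acyclic.
Variables (n : nat) (V E : finType) (G : lgraph n V E).

Implicit Types S : {set E}.

Let joins (p q : V * E) := ends G p.2 == [set p.1; q.1].

(** The edges chosen along a simple path are distinct, since each one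
    contains the vertex that the path leaves and later ones do not. The pair
    [(last x p, h)] leaves room for a closing edge [h]. *)
Lemma path_edges S x p h : path (adj G S) x p -> uniq (x :: p) ->
  exists c : seq (V * E),
    [/\ map fst (rcons c (last x p, h)) = x :: p,
        sorted joins (rcons c (last x p, h)), uniq (map snd c)
      & {in map snd c, forall e, e \in S /\ {subset ends G e <= x :: p}}].
Proof.
elim: p x => [|y p IH] x /=; first by exists [::].
case/andP => /existsP[e /andP[eS /eqP eE]] py /andP[xyp uyp].
have [c [cp cj cu cS]] := IH y py uyp.
exists ((x, e) :: c); split => /=.
- by rewrite cp.
- by case: (rcons c _) cp cj => //= q c' [qy _] ->; rewrite andbT /joins /= qy eE.
- rewrite cu andbT; apply/negP => /cS[_ /(_ x)]; rewrite eE !inE eqxx => /(_ isT).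
  by move: xyp; rewrite inE => /negPf ->.
- move=> f; rewrite inE => /orP[/eqP ->|/cS[fS sub]]; split => //.
    by move=> w; rewrite eE !inE => /orP[]/eqP ->; rewrite eqxx ?orbT.
  by move=> w /sub wyp; rewrite inE wyp orbT.
Qed.

(** A simple path joining the ends of [e] and avoiding [e] closes up, through
    [e], to a cycle; when the ends coincide that cycle is the loop [e]. *)
Lemma acyclic_bridged : (forall c, ~~ is_cycle G c) -> bridged G.
Proof.
move=> acyc e u v euv; apply/negP; rewrite sameside_sym => /connectP[p0 p0P].
case/shortenP: p0P => p pP uP _ uE.
have [c [cp cj cu cS]] := path_edges e pP uP.
have /negP[] := acyc (rcons c (u, e)); rewrite uE; apply/and4P; split.
- by case: (c).
- by rewrite cp.
- rewrite map_rcons rcons_uniq cu andbT; apply/negP => /cS[].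
  by rewrite !inE eqxx.
- case: c cp cj {cu cS} => [|q c] /= [qv _] cj.
    by rewrite /joins /= euv uE !qv eqxx.
  by rewrite (rcons_path joins) last_rcons cj /joins /= qv euv -uE setUC.
Qed.

Lemma path_joins_connect S q c q' : path joins q (rcons c q') ->
  {in q :: c, forall p, p.2 \in S} -> connect (adj G S) q.1 q'.1.
Proof.
have step p r : joins p r -> p.2 \in S -> connect (adj G S) p.1 r.1.
  by move=> pr pS; apply: connect1; apply/existsP; exists p.2; rewrite pS.
elim: c q => [|p c IH] q /=.
  by rewrite andbT => qq' cS; apply: step qq' _; apply: cS; rewrite inE.
case/andP => qp pc cS; apply: connect_trans (IH p pc _).
  by apply: step qp _; apply: cS; rewrite inE eqxx.
by move=> r rc; apply: cS; rewrite inE rc orbT.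
Qed.

Lemma bridged_acyclic : bridged G -> forall c, ~~ is_cycle G c.
Proof.
move=> bridG [//|[v e] c]; apply/negP; case/and4P => _ _ /= /andP[ec _] cc.
suff [w evw wv] : exists2 w, ends G e = [set v; w] & sameside G e w v.
  by case/negP: (bridG _ _ _ evw); rewrite sameside_sym.
case: c ec cc => [|q c] ec /=.
  by rewrite /joins /= andbT => /eqP evv; exists v => //; exact: connect0.
case/andP => /eqP evq qc; exists q.1 => //.
apply: (path_joins_connect qc) => p pc; rewrite !inE.
by apply: contraNneq ec => <-; exact: map_f.
Qed.

End Acyclic.

(** * Isomorphisms and contractions *)

Section Isomorphism.
Variables (n : nat) (V E V' E' : finType).
Variables (G : lgraph n V E) (G' : lgraph n V' E') (gV : V -> V') (gE : E -> E').
Hypothesis iso : is_liso G G' gV gE.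

Lemma liso_leg i : leg G' i = gV (leg G i).
Proof.
have [_ _ _ legE] := iso.
have : i \in legs G' (gV (leg G i)) by rewrite legE inE.
by rewrite inE => /eqP.
Qed.

Lemma liso_connect (S : {set E}) u v :
  connect (adj G' (gE @: S)) (gV u) (gV v) = connect (adj G S) u v.
Proof.
have [gVb gEb endsE _] := iso; have gVi := bij_inj gVb.
have [gV' gVK gV'K] := gVb.
apply/idP/idP => [|/connectP[p pp ->]].
  case/connectP => p; elim: p u => [|w' p IH] u /=.
    by move=> _ /gVi ->.
  case/andP => /existsP[_ /andP[/imsetP[e eS ->]]]; rewrite -(gV'K w').
  rewrite endsE -imset_pair => /eqP/(imset_inj gVi) euw pp vE.
  apply: connect_trans (IH _ pp vE); apply: connect1; apply/existsP.
  by exists e; rewrite eS euw /=.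
elim: p u pp => [|w p IH] u //= /andP[/existsP[e /andP[eS /eqP eE]] /IH].
apply: connect_trans; apply: connect1; apply/existsP; exists (gE e).
by rewrite imset_f //= endsE eE imset_pair.
Qed.

Lemma liso_sameside e u v : sameside G' (gE e) (gV u) (gV v) = sameside G e u v.
Proof.
have [_ gEb _ _] := iso; rewrite /sameside -liso_connect; congr (connect (adj _ _) _ _).
apply/setP => f; have [gE' gEK gE'K] := gEb.
by rewrite -(gE'K f) (mem_imset _ _ (bij_inj gEb)) !inE (inj_eq (bij_inj gEb)).
Qed.

Lemma liso_split e : leg_split G' (gE e) = leg_split G e.
Proof. by apply/ffunP => p; rewrite !ffunE !liso_leg liso_sameside. Qed.

Lemma liso_connected : connected_graph G -> connected_graph G'.
Proof.
have [[gV' gVK gV'K] gEb _ _] := iso; have [gE' gEK gE'K] := gEb.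
case=> V0 conn; split.
  by rewrite -(bij_eq_card (Bijective gVK gV'K)).
move=> u v; rewrite -(gV'K u) -(gV'K v).
rewrite (_ : [set: E'] = gE @: [set: E]) ?liso_connect //.
by apply/setP => e; rewrite inE -(gE'K e) imset_f.
Qed.

Lemma liso_bridged : bridged G -> bridged G'.
Proof.
have [gVb gEb endsE _] := iso => bridG e u v.
have [gV' gVK gV'K] := gVb; have [gE' gEK gE'K] := gEb.
rewrite -(gE'K e) -(gV'K u) -(gV'K v) endsE -imset_pair liso_sameside.
by move/(imset_inj (bij_inj gVb)); exact: bridG.
Qed.

Lemma liso_stable : is_stable G -> is_stable G'.
Proof.
have [gVb gEb endsE legE] := iso => stabG v.
have [gV' gVK gV'K] := gVb; have [gE' gEK gE'K] := gEb.
rewrite -(gV'K v) legE; apply: leq_trans (stabG (gV' v)) _.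
rewrite leq_add2r /valency -(card_imset [set e | gV' v \in ends G e] (bij_inj gEb)).
apply: subset_leq_card.
apply/subsetP => _ /imsetP[e ve ->]; move: ve; rewrite !inE endsE.
exact: imset_f.
Qed.

End Isomorphism.

Section Contraction.
Variables (n : nat) (V E : finType) (G : lgraph n V E) (S : {set E}).
Local Notation K := (contract G S).
Local Notation q := (contract_map G S).

Lemma contract_mapE u v : (q u == q v) = connect (adj G S) u v.
Proof.
rewrite -val_eqE /=; apply/eqP/idP => [/setP/(_ v)|uv].
  by rewrite !inE connect0.
by apply/setP => w; rewrite !inE; apply: same_connect uv _; exact: connect_adj_sym.
Qed.

Lemma contract_map_surj x : exists v, x = q v.
Proof.
by case: x => C Ci; have /imsetP[v _ CE] := Ci; exists v; exact: val_inj.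
Qed.

(** A path in the contraction lifts by inserting paths inside the contracted
    components, and a path in [G] descends by dropping its steps in [S]. *)
Lemma contract_connect (T : {set contract_edge S}) u v :
  connect (adj K T) (q u) (q v) = connect (adj G (S :|: val @: T)) u v.
Proof.
apply/idP/idP => [|/connectP[p pp ->]].
  have inS a b : q a = q b -> connect (adj G (S :|: val @: T)) a b.
    by move/eqP; rewrite contract_mapE; apply: connect_adjS; exact: subsetUl.
  case/connectP => p; elim: p u => [|w p IH] u /=.
    by move=> _ /inS; rewrite connect_adj_sym.
  case/andP => /existsP[e /andP[eT /eqP eE]] pp vE.
  have [u' u'e u'E] : exists2 u', u' \in ends G (val e) & q u = q u'.
    by apply/imsetP; rewrite -[_ @: _]/(ends K e) eE !inE eqxx.
  have [w' w'e w'E] : exists2 w', w' \in ends G (val e) & w = q w'.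
    by apply/imsetP; rewrite -[_ @: _]/(ends K e) eE !inE eqxx orbT.
  rewrite w'E in pp vE; apply: connect_trans (IH _ pp vE).
  apply: connect_trans (inS _ _ u'E) _; apply: connect_ends u'e w'e.
  by rewrite inE imset_f ?orbT.
elim: p u pp => [|w p IH] u //= /andP[/existsP[e /andP[eST /eqP eE]] /IH].
apply: connect_trans; move: eST; rewrite inE => /orP[eS|/imsetP[f fT ef]].
  rewrite (_ : q u = q w) //; apply/eqP; rewrite contract_mapE.
  by apply: (connect_ends eS); rewrite eE !inE eqxx ?orbT.
apply: connect1; apply/existsP; exists f; rewrite fT /= -ef eE.
by rewrite imset_pair.
Qed.

(** A path avoiding [e] may use the contracted edges freely, since [e] is not
    one of them. *)
Lemma contract_sameside e u v :
  sameside K e (q u) (q v) = sameside G (val e) u v.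
Proof.
rewrite /sameside contract_connect; congr (connect (adj _ _) _ _).
apply/setP => f; rewrite !inE; have [fS|fS] /= := boolP (f \in S).
  by apply/esym; apply: contraTneq fS => ->; exact: (valP e).
rewrite -[f]/(val (Sub f fS : contract_edge S)) (mem_imset _ _ val_inj) !inE.
by rewrite val_eqE.
Qed.

Lemma contract_split e : leg_split K e = leg_split G (val e).
Proof. by apply/ffunP => p; rewrite !ffunE contract_sameside. Qed.

Lemma contract_connected : connected_graph G -> connected_graph K.
Proof.
case=> /card_gt0P[v _] conn; split; first by apply/card_gt0P; exists (q v).
move=> x y; have [u ->] := contract_map_surj x; have [w ->] := contract_map_surj y.
rewrite contract_connect; have := conn u w; apply: connect_adjS.
apply/subsetP => e _; rewrite inE; have [//|eS] /= := boolP (e \in S).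
by apply/imsetP; exists (Sub e eS); rewrite ?inE.
Qed.

Hypothesis bridG : bridged G.

(** An edge of the contraction keeps its two ends, up to contracted paths, and
    these do not cross it. *)
Lemma contract_bridged : bridged K.
Proof.
move=> e x y; have [u ->] := contract_map_surj x; have [w ->] := contract_map_surj y.
move=> euw; rewrite contract_sameside.
have [a [b eab]] := ends_pair G (val e).
have ends_e z : (z == q a) || (z == q b) = (z == q u) || (z == q w).
  have /setP/(_ z) := euw; rewrite /= eab imset_pair !inE.
  by move->.
have same z t : q z = q t -> sameside G (val e) z t.
  by move/eqP; rewrite contract_mapE; apply: connect_sameside; exact: (valP e).
apply/negP => uw; case/negP: (bridG eab).
have wu : sameside G (val e) w u by rewrite sameside_sym.
have tr := @sameside_trans _ _ _ G (val e).
have all_u z : (z == q u) || (z == q w) -> forall t, z = q t -> sameside G (val e) t u.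
  move=> /orP[]/eqP zE t; rewrite zE => /esym/same; first by [].
  by move=> tw; exact: tr tw wu.
apply: (tr u); last rewrite sameside_sym.
  by apply: (all_u (q a)); rewrite -?ends_e ?eqxx.
by apply: (all_u (q b)); rewrite -?ends_e ?eqxx ?orbT.
Qed.

Lemma contract_stable : is_stable G -> is_stable K.
Proof.
move=> stabG x; have [c ->] := contract_map_surj x.
apply: leq_trans (card_outgoing_ge3 bridG stabG S c) _; rewrite card_outgoing leq_add //.
  rewrite -[X in (_ <= X)%N](card_imset _ val_inj); apply: subset_leq_card.
  apply/subsetP => e; rewrite inE => /andP[eS /existsP[u /andP[ue cu]]].
  apply/imsetP; exists (Sub e eS) => //; rewrite inE /=.
  by apply/imsetP; exists u => //; apply/eqP; rewrite contract_mapE.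
apply: subset_leq_card; apply/subsetP => i; rewrite !inE /= contract_mapE.
by rewrite connect_adj_sym.
Qed.

End Contraction.

(** The gluing of cones only mentions trees on standard vertex and edge sets, so
    a contraction has to be renumbered before it can serve as a cell. *)
Section Relabel.
Variables (n : nat) (V E : finType) (G : lgraph n V E).

Fact relabel_ends_card (e : 'I_#|E|) :
  (0 < #|(@enum_rank V @: ends G (enum_val e))| <= 2)%N.
Proof. by rewrite card_imset ?ends_card //; exact: enum_rank_inj. Qed.

Definition relabel : lgraph n 'I_#|V| 'I_#|E| :=
  LGraph (fun i => enum_rank (leg G i)) relabel_ends_card.

Lemma relabel_liso : is_liso G relabel enum_rank enum_rank.
Proof.
split; [exact: enum_rank_bij..| |].
  by move=> e; rewrite /= enum_rankK.
by move=> v; apply/setP => i; rewrite !inE /= (inj_eq enum_rank_inj).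
Qed.

End Relabel.

Lemma stree_connected n (G : stree n) : connected_graph G.
Proof. by have [] := stree_tree G. Qed.

Lemma stree_bridged n (G : stree n) : bridged G.
Proof. by have [_ /acyclic_bridged] := stree_tree G. Qed.

Lemma contract_stree n (G : stree n) (S : {set 'I_(ne G)}) :
  exists (K : stree n) gV gE, is_liso (contract G S) K gV gE.
Proof.
have iso := relabel_liso (contract G S).
have treeK : is_tree (relabel (contract G S)).
  split; first exact: liso_connected iso (contract_connected _ (stree_connected G)).
  apply: bridged_acyclic; apply: liso_bridged iso _.
  exact/contract_bridged/stree_bridged.
have stabK : is_stable (relabel (contract G S)).
  apply: liso_stable iso _.
  by apply: contract_stable; [exact: stree_bridged|exact: stree_stable].
by exists (STree treeK stabK); exists enum_rank, enum_rank.
Qed.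

From mathcomp Require Import all_classical all_reals all_analysis.
Import Order.TTheory GRing.Theory Num.Theory numFieldNormedType.Exports.

Local Open Scope classical_set_scope.
Local Open Scope ring_scope.
Local Open Scope quotient_scope.

(** * Split coordinates on a glued complex *)

Section Width.
Variables (n : nat) (T : topologicalType) (z : T).
Implicit Types (s : {ffun 'I_n * 'I_n -> bool}) (p q : cones n T).

(** At most one edge can be picked, by [stree_leg_split_inj]. *)
Definition cones_width s p : T :=
  if [pick e | leg_split (tag p) e == s] is Some e then tagged p e else z.

Lemma stree_leg_split_inj (G : stree n) : injective (leg_split G).
Proof. by apply: leg_split_inj; [exact: stree_bridged|exact: stree_stable]. Qed.

Lemma cones_width_split (G : stree n) (x : cone T G) e :
  cones_width (leg_split G e) (existT _ G x) = x e.
Proof.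
rewrite /cones_width /=; case: pickP => [f /eqP /stree_leg_split_inj -> //|].
by move=> /(_ e); rewrite eqxx.
Qed.

Lemma cones_width_edge (G : stree n) (x : cone T G) s :
  cones_width s (existT _ G x) <> z ->
  exists2 e, leg_split G e = s & cones_width s (existT _ G x) = x e.
Proof. by rewrite /cones_width /=; case: pickP => // e /eqP; exists e. Qed.

(** An edge contracted by the gluing has length [z], and its split disappears
    from the contraction because the splits of [G] are distinct; the other
    edges keep both split and length. *)
Lemma face_glue_width p q s : face_glue z p q ->
  cones_width s p = cones_width s q.
Proof.
case: p q => [G x] [H y] [S [gV [gE [/= iso xS xE]]]].
have spl e : leg_split H (gE e) = leg_split G (val e).
  by rewrite (liso_split iso) contract_split.
have [_ [gE' gEK gE'K] _ _] := iso.
rewrite /cones_width /=; case: (pickP (fun e => leg_split H e == s)) => [f /eqP <-|noH].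
  rewrite -(gE'K f) spl; case: pickP => [e /eqP/stree_leg_split_inj ->|].
    by rewrite xE.
  by move/(_ (val (gE' f))); rewrite eqxx.
case: pickP => // e /eqP es; have [/xS //|eS] := boolP (e \in S).
by have := noH (gE (Sub e eS)); rewrite spl /= es eqxx.
Qed.

Lemma glue_rel_width p q : glue_rel z p q ->
  forall s, cones_width s p = cones_width s q.
Proof.
move=> /asboolP pq s; elim: pq => [a b|//|a b _ ->//|a b c _ -> _ ->//].
exact: face_glue_width.
Qed.

(** Contract in both trees the edges of length [z]. The remaining edges are
    matched by their splits, so by [reconstruction] both contractions are
    isomorphic to one tree [K], with the same edge lengths. *)
Lemma width_glue_rel p q : (forall s, cones_width s p = cones_width s q) ->
  glue_rel z p q.
Proof.
case: p q => [G x] [H y] xy.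
pose S := [set e | `[< x e = z >]]%SET; pose S' := [set e | `[< y e = z >]]%SET.
have edge (G1 G2 : stree n) (x1 : cone T G1) (x2 : cone T G2) :
    (forall s, cones_width s (existT _ G1 x1) = cones_width s (existT _ G2 x2)) ->
    forall e : contract_edge [set e | `[< x1 e = z >]]%SET,
    exists f : contract_edge [set e | `[< x2 e = z >]]%SET,
    leg_split G2 (val f) = leg_split G1 (val e).
  move=> x12 [e /= eS].
  have xe : x1 e <> z by move/asboolP => xe; move: eS; rewrite finset.inE xe.
  rewrite -(cones_width_split x1) x12 in xe.
  have [f fe xf] := cones_width_edge xe.
  suff fS : f \notin [set e | `[< x2 e = z >]]%SET by exists (Sub f fS).
  by rewrite finset.inE; apply/asboolP; rewrite -xf.
have [g gP] := fin_all_exists (edge _ _ _ _ (fun s => esym (xy s))).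
have [g' g'P] := fin_all_exists (edge _ _ _ _ xy).
have gK : cancel g g'.
  by move=> e; apply/val_inj/stree_leg_split_inj; rewrite g'P gP.
have g'K : cancel g' g.
  by move=> e; apply/val_inj/stree_leg_split_inj; rewrite gP g'P.
have [K [gV [gE iso]]] := contract_stree S.
have [_ gEb _ _] := iso; have [gE' gEK gE'K] := gEb.
have [hV isoH] : exists hV, is_liso (Defs.contract H S') K hV (gE \o g).
  apply: reconstruction.
  - exact/contract_connected/stree_connected.
  - exact/contract_bridged/stree_bridged.
  - apply: contract_stable; [exact: stree_bridged|exact: stree_stable].
  - exact: stree_connected.
  - exact: stree_bridged.
  - exact: stree_stable.
  - by apply: bij_comp gEb (Bijective gK g'K).
  - by move=> e; rewrite (liso_split iso) !contract_split gP.
(* The common point of the cone of [K] to which both points are glued. *)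
pose w : cone T K := fun k => x (val (gE' k)).
have zS (G1 : stree n) (x1 : cone T G1) e :
    e \in [set e | `[< x1 e = z >]]%SET -> x1 e = z.
  by rewrite finset.inE => /asboolP.
apply: (glue_rel_trans (y := existT _ K w)).
  apply/asboolP/rst_step; exists S, gV, gE; split => //=; first exact: zS.
  by move=> e; rewrite /w gEK.
rewrite glue_rel_sym; apply/asboolP/rst_step; exists S', hV, (gE \o g).
split => //=; first exact: zS.
by move=> e; rewrite /w gEK -cones_width_split -(cones_width_split y) xy gP.
Qed.

Definition width s (p : cone_complex n z) : T := cones_width s (repr p).

Lemma width_point s (G : stree n) (x : cone T G) :
  width s (point_of z x) = cones_width s (existT _ G x).
Proof.
apply: glue_rel_width; have := reprK (point_of z x).
by move=> /eqmodP.
Qed.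

Lemma width_inj (p q : cone_complex n z) : (forall s, width s p = width s q) -> p = q.
Proof.
elim/cone_point_ind: p => G x; elim/cone_point_ind: q => H y xy.
apply/eqmodP; apply: width_glue_rel => s; rewrite -!width_point; exact: xy.
Qed.

Lemma point_of_continuous (G : stree n) : continuous (@point_of n T z G).
Proof.
move=> x; apply: (continuous_comp (@existT_continuous _ (cone T) G x)).
exact: (@pi_continuous _ {eq_quot (glue_equiv n z)}).
Qed.

Lemma cone_complex_continuous (Z : topologicalType) (f : cone_complex n z -> Z) :
  (forall G : stree n, continuous (fun x : cone T G => f (point_of z x))) ->
  continuous f.
Proof.
move=> cf; apply/quotient_continuous.
by case=> G x U /cf; exact: existT_continuous.
Qed.

Lemma width_continuous s : continuous (width s).
Proof.
apply: cone_complex_continuous => G.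
have [[e <-]|noe] := pselect (exists e, leg_split G e = s).
  rewrite (_ : (fun x => _) = (fun x : cone T G => x e)).
    exact: cone_coord_continuous.
  by apply/funext => x; rewrite width_point cones_width_split.
rewrite (_ : (fun x => _) = (fun x : cone T G => z)); first exact: cst_continuous.
apply/funext => x; rewrite width_point /cones_width /=; case: pickP => // e /eqP es.
by case: noe; exists e.
Qed.

End Width.

(** * Separation and density *)

Lemma jointly_injective_hausdorff (I : Type) (S T : topologicalType) (f : I -> S -> T) :
  hausdorff_space T -> (forall i, continuous (f i)) ->
  (forall x y, (forall i, f i x = f i y) -> x = y) -> hausdorff_space S.
Proof.
move=> hT cf f_inj x y xy; apply: f_inj => i; apply: hT => A B Ax By.
by have [z [Az Bz]] := xy _ _ (cf i x _ Ax) (cf i y _ By); exists (f i z).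
Qed.

Lemma cone_complex_hausdorff n (T : topologicalType) (z : T) :
  hausdorff_space T -> hausdorff_space (cone_complex n z).
Proof.
move=> hT; apply: (jointly_injective_hausdorff hT (@width_continuous n T z)).
exact: width_inj.
Qed.

Lemma cone_continuous n (T Z : topologicalType) (G : stree n) (f : Z -> cone T G) :
  (forall i, continuous (fun x => f x i)) -> continuous f.
Proof. by move=> cf x; apply/cvg_sup => i; apply: initial_cvg; exact: cf. Qed.

Lemma cones_width_comp n (T T' : topologicalType) (z : T) (z' : T') (h : T -> T')
    s (G : stree n) (x : cone T G) : h z = z' ->
  cones_width z' s (existT (cone T') G (h \o x)) = h (cones_width z s (existT _ G x)).
Proof. by move=> hz; rewrite /cones_width /=; case: pickP => //. Qed.

Section Extension.
Variables (R : realType) (n : nat).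
Local Notation zero := (nnreal0 R).
Local Notation ezero := (nnereal0 R).
Implicit Types (f : trop R n -> trop R n) (F : extended_trop R n -> extended_trop R n).

Lemma nnreal_continuous (Z : topologicalType) (f : Z -> nnreal R) :
  continuous (fun x => \val (f x) : R) -> continuous f.
Proof. by move=> cf x; apply: initial_cvg; exact: cf. Qed.

Lemma nnereal_continuous (Z : topologicalType) (f : Z -> nnereal R) :
  continuous (fun x => \val (f x) : \bar R) -> continuous f.
Proof. by move=> cf x; apply: initial_cvg; exact: cf. Qed.

Lemma nnreal_val_continuous : continuous (fun x : nnreal R => \val x : R).
Proof. exact: (@initial_continuous _ _ set_val). Qed.

Lemma cone_val_continuous (G : stree n) j :
  continuous (fun x : cone (nnreal R) G => \val (x j) : R).
Proof.
move=> x; apply: (continuous_comp (@cone_coord_continuous _ _ _ j x)).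
exact: nnreal_val_continuous.
Qed.

Lemma cone_ereal_val_continuous (G : stree n) j :
  continuous (fun x : cone (nnereal R) G => \val (x j) : \bar R).
Proof.
move=> x; apply: (continuous_comp (@cone_coord_continuous _ _ _ j x)).
exact: nnereal_val_continuous.
Qed.

Lemma extended_trop_hausdorff : hausdorff_space (extended_trop R n).
Proof.
apply: cone_complex_hausdorff.
pose v (_ : unit) (x : nnereal R) : \bar R := \val x.
apply: (jointly_injective_hausdorff (f := v)).
- exact: ereal_hausdorff.
- by case; exact: nnereal_val_continuous.
- by move=> x y /(_ tt) xy; exact: val_inj.
Qed.

Lemma nnreal_ext0 : nnreal_ext zero = ezero.
Proof. exact: val_inj. Qed.

Lemma width_trop_incl s (p : trop R n) : width s (trop_incl p) = nnreal_ext (width s p).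
Proof.
elim/cone_point_ind: p => G x; rewrite trop_incl_point !width_point.
exact: (cones_width_comp _ _ nnreal_ext0).
Qed.

Lemma trop_incl_inj : injective (@trop_incl R n).
Proof.
move=> p q pq; apply: width_inj => s.
have := congr1 (width s) pq; rewrite !width_trop_incl => /(congr1 val)[].
exact: val_inj.
Qed.

(** [trunc] on points of the complex rather than on representatives. *)
Definition trop_trunc m (p : extended_trop R n) : trop R n :=
  point_of zero (trunc m (tagged (repr p))).

(** Truncation fixes zero, so it commutes with the split coordinates and
    respects the gluing. *)
Lemma trop_trunc_point m (G : stree n) (x : cone (nnereal R) G) :
  trop_trunc m (point_of ezero x) = point_of zero (trunc m x).
Proof.
pose h (a : nnereal R) : nnreal R := exist _ (trunc_val m a) (trunc_val_ge0 m a).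
have h0 : h ezero = zero.
  by apply: val_inj; rewrite /= /trunc_val.
apply: width_inj => s; rewrite /trop_trunc !width_point.
rewrite -[trunc m _]/(h \o _) -[trunc m x]/(h \o _) !(cones_width_comp _ _ h0); congr h.
rewrite -!width_point; congr width.
set p := point_of ezero x; rewrite -[RHS](@reprK _ {eq_quot (glue_equiv n ezero)} p).
by rewrite /point_of; case: (repr p).
Qed.

Lemma trop_trunc_cvg p : (fun m => trop_incl (trop_trunc m p)) @ \oo --> p.
Proof.
elim/cone_point_ind: p => G x.
rewrite (_ : (fun m => _) = (fun m => point_of ezero (cone_ext (trunc m x)))); last first.
  by apply/funext => m; rewrite trop_trunc_point trop_incl_point.
exact: (cvg_comp _ _ (@trunc_cvg _ _ _ x) (@point_of_continuous _ _ _ _ x)).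
Qed.

Lemma extended_trop_ext F F' : continuous F -> continuous F' ->
  (forall p, F (trop_incl p) = F' (trop_incl p)) -> F = F'.
Proof.
move=> cF cF' FF'; apply/funext => p.
have Fp := cvg_comp _ _ (@trop_trunc_cvg p) (cF p).
apply: (cvg_unique extended_trop_hausdorff Fp).
rewrite (_ : F \o _ = F' \o (fun m => trop_incl (trop_trunc m p))).
  exact: (cvg_comp _ _ (@trop_trunc_cvg p) (cF' p)).
by apply/funext => m; exact: FF'.
Qed.

(** * Extension by linearity *)

(** Continuity on a glued complex is tested on each cone, where [f] is a linear
    map followed by the projection of another cone. *)
Lemma linear_on_continuous f :
  (forall G, exists (H : stree n) (A : 'M[int]_(ne H, ne G)), linear_on f A) ->
  continuous f.
Proof.
move=> lin; apply: cone_complex_continuous => G; have [H [A fA]] := lin G.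
have /choice[y yP] : forall x, exists y : cone (nnreal R) H,
    (forall i, \val (y i) = lin_image A x i) /\
    f (point_of zero x) = point_of zero y.
  by move=> x; have [y yA fy] := fA x; exists y.
rewrite (_ : (fun x => _) = (fun x => point_of zero (y x))); last first.
  by apply/funext => x; have [_ ->] := yP x.
move=> x; apply: continuous_comp (@point_of_continuous _ _ _ _ _).
move: x; apply: cone_continuous => i; apply: nnreal_continuous.
rewrite (_ : (fun x => _) = (fun x : cone (nnreal R) G => lin_image A x i)); last first.
  by apply/funext => x; have [-> _] := yP x.
apply: continuous_big => [|j _ x]; first exact: add_continuous.
apply: cvgMl_tmp; first exact: nbhs_filter.
exact: cone_val_continuous.
Qed.

(** Evaluate at the unit vectors. *)
Lemma linear_on_ge0 f (G H : stree n) (A : 'M[int]_(ne H, ne G)) :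
  linear_on f A -> forall i j, 0 <= A i j.
Proof.
move=> fA i j; pose d : cone (nnreal R) G := fun k =>
  exist _ (k == j)%:R (mem_set (ler0n R (k == j) : [set x : R | 0 <= x] _)).
have [y yE _] := fA d; have := set_valP (y i); rewrite /= [X in 0 <= X]yE /lin_image.
rewrite (bigD1 j)//= eqxx mulr1 big1 ?addr0 ?ler0z// => k kj.
by rewrite (negPf kj) mulr0.
Qed.

Section ExtLinear.
Variables (G H : stree n) (A : 'M[int]_(ne H, ne G)).
Hypothesis A0 : forall i j, 0 <= A i j.

Fact ext_linear_ge0 (x : cone (nnereal R) G) i :
  (\sum_j ((A i j)%:~R)%:E * \val (x j))%E \in [set x : \bar R | (0 <= x)%E].
Proof.
apply/mem_set; apply: sume_ge0 => j _; apply: mule_ge0; last exact: (set_valP (x j)).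
by rewrite lee_fin ler0z.
Qed.

Definition ext_linear (x : cone (nnereal R) G) : cone (nnereal R) H :=
  fun i => exist _ (\sum_j ((A i j)%:~R)%:E * \val (x j))%E (ext_linear_ge0 x i).

Lemma ext_linear_continuous : continuous ext_linear.
Proof.
apply: cone_continuous => i; apply: nnereal_continuous => x /=.
apply: cvg_nnesum => [|j _|j _]; first exact: nbhs_pfilter.
  apply: nearW; first exact: nbhs_filter.
  move=> y; apply: mule_ge0; last exact: (set_valP (y j)).
  by rewrite lee_fin ler0z.
apply: cvgeZl => //.
exact: cone_ereal_val_continuous.
Qed.

Lemma ext_linear_finite (x : cone (nnreal R) G) i :
  \val (ext_linear (cone_ext x) i) = (lin_image A x i)%:E.
Proof. by rewrite /= /lin_image -sumEFin; apply: eq_bigr => j _; rewrite EFinM. Qed.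

Lemma ext_linear_morphism : is_ext_cone_morphism ext_linear.
Proof.
split; first exact: ext_linear_continuous.
by exists finset.set0, A => x i; rewrite finset.in_set0 ext_linear_finite.
Qed.

Lemma ext_linear_point f (x : cone (nnreal R) G) : linear_on f A ->
  point_of ezero (ext_linear (cone_ext x)) = trop_incl (f (point_of zero x)).
Proof.
move=> /(_ x)[y yE ->]; rewrite trop_incl_point; congr point_of.
by apply/funext => i; apply: val_inj; rewrite ext_linear_finite -yE.
Qed.

(** The right-hand side depends on the chosen cone and matrix but the sequence
    does not. This is what makes the extension well defined. *)
Lemma ext_linear_cvg f (x : cone (nnereal R) G) : linear_on f A ->
  (fun m => trop_incl (f (trop_trunc m (point_of ezero x)))) @ \oo -->
  point_of ezero (ext_linear x).
Proof.
move=> fA.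
rewrite (_ : (fun m => _) =
  (fun m => point_of ezero (ext_linear (cone_ext (trunc m x))))); last first.
  by apply/funext => m; rewrite trop_trunc_point (ext_linear_point _ fA).
have c : {for x, continuous (fun x => point_of ezero (ext_linear x))}.
  by apply: continuous_comp; [exact: ext_linear_continuous|exact: point_of_continuous].
exact: (cvg_comp _ _ (@trunc_cvg _ _ _ x) c).
Qed.

End ExtLinear.

Lemma extension_exists f : is_morphism f ->
  exists F, [/\ is_ext_morphism F, restricts_to F f
    & forall (G H : stree n) (A : 'M[int]_(ne H, ne G)),
        linear_on f A -> ext_linear_on F A].
Proof.
move=> [_ lin].
have /choice[F FP] : forall p, exists q,
    (fun m => trop_incl (f (trop_trunc m p))) @ \oo --> (q : extended_trop R n).
  elim/cone_point_ind => G x; have [H [A fA]] := lin G.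
  exists (point_of ezero (ext_linear (linear_on_ge0 fA) x)); exact: ext_linear_cvg.
have FE (G H : stree n) (A : 'M[int]_(ne H, ne G)) (fA : linear_on f A) x :
    F (point_of ezero x) = point_of ezero (ext_linear (linear_on_ge0 fA) x).
  apply: (cvg_unique extended_trop_hausdorff (FP _)); exact: ext_linear_cvg.
have FA (G H : stree n) (A : 'M[int]_(ne H, ne G)) :
    linear_on f A -> ext_linear_on F A.
  by move=> fA x; exists (ext_linear (linear_on_ge0 fA) x).
exists F; split => //; last first.
  elim/cone_point_ind => G x; have [H [A fA]] := lin G.
  by rewrite trop_incl_point (FE _ _ _ fA) (ext_linear_point _ _ fA).
split.
  apply: cone_complex_continuous => G; have [H [A fA]] := lin G.
  rewrite (_ : (fun x => _) =
      (fun x => point_of ezero (ext_linear (linear_on_ge0 fA) x))).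
    move=> x; apply: continuous_comp; first exact: ext_linear_continuous.
    exact: point_of_continuous.
  by apply/funext => x; exact: FE.
move=> G; have [H [A fA]] := lin G.
exists H, (ext_linear (linear_on_ge0 fA)); split; first exact: ext_linear_morphism.
exact: FE.
Qed.

End Extension.

(** * Restriction to finite points *)

Section Restriction.
Variables (R : realType) (n : nat).
Local Notation zero := (nnreal0 R).
Local Notation ezero := (nnereal0 R).
Variable F : extended_trop R n -> extended_trop R n.
Hypotheses (F_mor : is_ext_morphism F) (F_surj : forall q, exists p, F p = q).

Definition apex (G : stree n) : cone (nnreal R) G := fun=> zero.

Lemma width_apex s (G : stree n) : width s (point_of ezero (cone_ext (@apex G))) = ezero.
Proof.
rewrite width_point /cones_width /=; case: pickP => // e _; exact: val_inj.
Qed.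

(** An infinite coordinate at the apex propagates to every cone, because the
    cones share their apex [o], and then to the whole complex; but [o] is
    a value of [F]. *)
Lemma no_face_at_infinity (G H : stree n) (phi : cone (nnereal R) G -> cone (nnereal R) H)
    (S : {set 'I_(ne H)}) (A : 'M[int]_(ne H, ne G)) :
  (forall x, F (point_of ezero x) = point_of ezero (phi x)) ->
  (forall (x : cone (nnreal R) G) i,
    \val (phi (cone_ext x) i) = if i \in S then +oo%E else (lin_image A x i)%:E) ->
  S = finset.set0.
Proof.
move=> FE phiE; apply/finset.setP => i; rewrite finset.in_set0; apply/negP => iS.
pose o := point_of ezero (cone_ext (@apex G)).
have Fo : \val (width (leg_split H i) (F o)) = +oo%E.
  by rewrite /o FE width_point cones_width_split phiE iS.
have Foo p : \val (width (leg_split H i) (F p)) = +oo%E.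
  elim/cone_point_ind: p => G' x.
  have [H' [psi [[cpsi [S' [B psiE]]] FE']]] := F_mor.2 G'.
  have oE : o = point_of ezero (cone_ext (@apex G')).
    by apply: width_inj => s; rewrite /o !width_apex.
  have wo : cones_width ezero (leg_split H i)
      (existT _ H' (psi (cone_ext (@apex G')))) <> ezero.
    by rewrite -width_point -FE' -oE => h; move: Fo; rewrite h.
  have [j ji jo] := cones_width_edge wo.
  rewrite FE' width_point -ji cones_width_split (ext_cone_morphismE cpsi psiE).
  (* A linear map is finite at the apex, so this coordinate is infinite because
     the cone of [G'] is sent to a face at infinity. *)
  suff -> : j \in S' by [].
  move: Fo; rewrite oE FE' width_point jo psiE; by case: ifP.
have [p pE] := F_surj o; have := Foo p.
by rewrite pE width_apex.
Qed.

(** With no coordinate at infinity, [F] maps each cone linearly to a cone. *)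
Lemma restriction_exists : exists f, is_morphism f /\ restricts_to F f.
Proof.
have lin G : exists (H : stree n) (A : 'M[int]_(ne H, ne G)),
    forall x : cone (nnreal R) G, exists2 y : cone (nnreal R) H,
    (forall i, \val (y i) = lin_image A x i)
    & F (point_of ezero (cone_ext x)) = point_of ezero (cone_ext y).
  have [H [phi [[cphi [S [A phiE]]] FE]]] := F_mor.2 G.
  exists H, A => x; have S0 := no_face_at_infinity FE phiE.
  have phix i : \val (phi (cone_ext x) i) = (lin_image A x i)%:E.
    by rewrite phiE S0 finset.in_set0.
  have Ax i : lin_image A x i \in [set x : R | 0 <= x].
    apply/mem_set; have := set_valP (phi (cone_ext x) i).
    by rewrite /= [X in (_ <= X)%E]phix lee_fin.
  exists (fun i => exist _ (lin_image A x i) (Ax i)) => //; rewrite FE; congr point_of.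
  by apply/funext => i; apply: val_inj; rewrite phix.
have /choice[f fP] : forall p, exists q : trop R n, F (trop_incl p) = trop_incl q.
  elim/cone_point_ind => G x; have [H [A /(_ x)[y _ Fy]]] := lin G.
  by exists (point_of zero y); rewrite !trop_incl_point.
have flin G : exists (H : stree n) (A : 'M[int]_(ne H, ne G)), linear_on f A.
  have [H [A HA]] := lin G; exists H, A => x; have [y yE Fy] := HA x.
  by exists y => //; apply: trop_incl_inj; rewrite -fP !trop_incl_point.
by exists f; split => //; split => //; exact: linear_on_continuous.
Qed.

End Restriction.

(** * The two automorphism groups *)

Lemma aut_restriction (R : realType) n (F : Aut_extended_trop R n) :
  exists f : Aut_trop R n, restricts_to F f.
Proof.
have [F' [F'm FF' F'F]] := aut_invertible F.
have [f [fm fF]] : exists f, is_morphism f /\ restricts_to F f.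
  by apply: restriction_exists (aut_endo F) _ => q; exists (F' q).
have [f' [f'm f'F']] : exists f, is_morphism f /\ restricts_to F' f.
  by apply: restriction_exists F'm _ => q; exists (F q).
have inv : exists g, [/\ endo (trop_endo R n) g, cancel f g & cancel g f].
  exists f'; split=> [|p|p]; first exact: f'm; apply: trop_incl_inj.
    by rewrite -(f'F' (f p)) -(fF p) FF'.
  by rewrite -(fF (f' p)) -(f'F' p) F'F.
by exists (@Aut _ (trop_endo R n) f fm inv).
Qed.

Definition restriction (R : realType) n (F : Aut_extended_trop R n) : Aut_trop R n :=
  projT1 (cid (aut_restriction F)).

Lemma restriction_restricts (R : realType) n (F : Aut_extended_trop R n) :
  restricts_to F (restriction F).
Proof. exact: projT2 (cid (aut_restriction F)). Qed.

Lemma restricts_to_uniq (R : realType) n (F : Aut_extended_trop R n) (f : Aut_trop R n) :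
  restricts_to F f -> restriction F = f.
Proof.
move=> Ff; apply: aut_ext => p; apply: trop_incl_inj.
exact: etrans (esym (restriction_restricts F p)) (Ff p).
Qed.

Fact restrictionM (R : realType) n :
  {morph @restriction R n : F F' / (F * F')%g}.
Proof.
move=> F F'; apply: restricts_to_uniq => p.
rewrite autM (restriction_restricts F' p); exact: restriction_restricts.
Qed.

HB.instance Definition _ (R : realType) n :=
  isMultiplicative.Build (Aut_extended_trop R n) (Aut_trop R n)
    (@restriction R n) (@restrictionM R n).

(** The extensions of a morphism and of its inverse compose to the identity,
    since they do so on the dense set of finite points. *)
Lemma aut_extension (R : realType) n (f : Aut_trop R n) :
  exists F : Aut_extended_trop R n, restricts_to F f /\
    forall (G H : stree n) (A : 'M[int]_(ne H, ne G)),
      linear_on f A -> ext_linear_on F A.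
Proof.
have [f' [f'm ff' f'f]] := aut_invertible f.
have [F [Fm Ff FA]] := extension_exists (aut_endo f).
have [F' [F'm F'f' _]] := extension_exists f'm.
have inverse F1 F2 (f1 f2 : trop R n -> trop R n) :
    is_ext_morphism F1 -> is_ext_morphism F2 ->
    restricts_to F1 f1 -> restricts_to F2 f2 ->
    cancel f1 f2 -> cancel F1 F2.
  move=> m1 m2 r1 r2 f12 p.
  suff F21 : F2 \o F1 = id by exact: (congr1 (fun h => h p) F21).
  apply: (extended_trop_ext (is_ext_morphism_comp m2 m1).1 (is_ext_morphism_id R n).1).
  by move=> q /=; rewrite (r1 q) (r2 (f1 q)) f12.
have inv : exists g, [/\ endo (extended_trop_endo R n) g, cancel F g & cancel g F].
  exists F'; split => //; [exact: inverse Ff F'f' ff'|exact: inverse F'f' Ff f'f].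
by exists (@Aut _ (extended_trop_endo R n) F Fm inv).
Qed.

Definition extension (R : realType) n (f : Aut_trop R n) : Aut_extended_trop R n :=
  projT1 (cid (aut_extension f)).

Lemma extension_restricts (R : realType) n (f : Aut_trop R n) :
  restricts_to (extension f) f.
Proof. by have [] := projT2 (cid (aut_extension f)). Qed.

Lemma extension_linear (R : realType) n (f : Aut_trop R n) (G H : stree n)
    (A : 'M[int]_(ne H, ne G)) : linear_on f A -> ext_linear_on (extension f) A.
Proof. by have [_] := projT2 (cid (aut_extension f)); apply. Qed.

Lemma extension_uniq (R : realType) n (f : Aut_trop R n)
    (h : extended_trop R n -> extended_trop R n) :
  continuous h -> restricts_to h f -> h = extension f.
Proof.
move=> ch hf; apply: extended_trop_ext ch (aut_endo (extension f)).1 _ => p.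
exact: etrans (hf p) (esym (extension_restricts f p)).
Qed.

Theorem proposition2p3 (R : realType) (n : nat) (hn : (3 <= n)%N) :
  exists (restrict : {multiplicative Aut_extended_trop R n -> Aut_trop R n})
         (extend : Aut_trop R n -> Aut_extended_trop R n),
    [/\ cancel restrict extend,
        cancel extend restrict,
        (forall F : Aut_extended_trop R n, restricts_to F (restrict F)),
        (forall (f : Aut_trop R n)
                (h : extended_trop R n -> extended_trop R n),
           (continuous h /\ restricts_to h f) <-> h = extend f)
      & (forall (f : Aut_trop R n) (G H : stree n)
                (A : 'M[int]_(ne H, ne G)),
           linear_on f A -> ext_linear_on (extend f) A)].
Proof.
exists (@restriction R n), (@extension R n); split.
- move=> F; apply: aut_ext => p; rewrite -(extension_uniq (aut_endo F).1 (h := F)) //.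
  exact: restriction_restricts.
- move=> f; apply: restricts_to_uniq; exact: extension_restricts.
- exact: restriction_restricts.
- move=> f h; split => [[ch hf]|->]; first exact: extension_uniq.
  by split; [exact: (aut_endo (extension f)).1|exact: extension_restricts].
- exact: extension_linear.
Qed.
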